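(* Let $k \geq 2$ be an integer and let $E \subset \mathbb{N}$ be a generalised polynomial set such that $k^n \in E$ for all integers $n \geq 0$. Then the set \[ \{ m \in \mathbb{N} : m k^n \in E \text{ for infinitely many } n \geq 0\} \] is $\mathrm{IP}^*_+$. In particular, the set $\{k^n : n \geq 0\}$ is not a generalised polynomial set.
   Context: $\mathbb{N}=\{1,2,\dots\}$. Generalised polynomials $\mathbb{R}^d\to\mathbb{R}$ form the smallest family of maps containing the constant maps and the coordinate maps $x\mapsto x_i$ and closed under addition, multiplication and taking the integer part $g\mapsto \lfloor g\rfloor$; a generalised polynomial on a domain $\Omega\subset\mathbb{R}^d$ is the restriction of one to $\Omega$. A set $E\subset\mathbb{N}$ is a generalised polynomial set if $E=\{n\in\mathbb{N} : g(n)=0\}$ for some generalised polynomial $g$. A set $E\subset \mathbb{N}$ is $\mathrm{IP}$ if it contains all finite sums $\sum_{i\in I} n_i$ ($I\subset\mathbb{N}$ finite, nonempty) of some sequence $(n_i)_{i\ge1}$ in $\mathbb{N}$; it is $\mathrm{IP}^*$ if it intersects every $\mathrm{IP}$ set; it is $\mathrm{IP}^*_+$ if some translate of it is an $\mathrm{IP}^*$ set. *)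

(* Defs.v *)
From HB Require Import structures.
From mathcomp Require Import all_boot all_order all_algebra finmap.
From mathcomp Require Import boolp classical_sets functions cardinality reals.

Set Implicit Arguments.
Unset Strict Implicit.
Unset Printing Implicit Defensive.

Import Order.TTheory GRing.Theory Num.Theory.
Local Open Scope classical_set_scope.
Local Open Scope ring_scope.

Inductive generalised_polynomial (R : realType) (d : nat) :
    ('rV[R]_d -> R) -> Prop :=
| gp_const (c : R) : generalised_polynomial (fun _ => c)
| gp_coord (i : 'I_d) : generalised_polynomial (fun x => x ord0 i)
| gp_add (f g : 'rV[R]_d -> R) :
    generalised_polynomial f -> generalised_polynomial g ->
    generalised_polynomial (fun x => f x + g x)
| gp_mul (f g : 'rV[R]_d -> R) :
    generalised_polynomial f -> generalised_polynomial g ->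
    generalised_polynomial (fun x => f x * g x)
| gp_floor (g : 'rV[R]_d -> R) :
    generalised_polynomial g ->
    generalised_polynomial (fun x => (Num.floor (g x))%:~R).

(* The set N = {1, 2, ...}. Subsets of N are represented as sets of natural
   numbers not containing 0. *)
Definition posnats : set nat := [set n | (0 < n)%N].

Definition generalised_polynomial_set (R : realType) (E : set nat) : Prop :=
  exists2 g : 'rV[R]_1 -> R, generalised_polynomial g &
    E = [set n | posnats n /\ g (const_mx n%:R) = 0].

Definition IP_set (E : set nat) : Prop :=
  E `<=` posnats /\
  exists2 u : nat -> nat, (forall i, posnats (u i)) &
    forall I : {fset nat}, I != fset0 -> E (\sum_(i <- I) u i)%N.

Definition IP_star (E : set nat) : Prop :=
  E `<=` posnats /\ forall A : set nat, IP_set A -> E `&` A !=set0.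

(* The translate (E + t) `&` N. The shift t may be negative, in which case
   the part of E + t falling outside N is discarded. *)
Definition translate (E : set nat) (t : int) : set nat :=
  [set n | posnats n /\ exists2 m, E m & n%:Z = m%:Z + t].

Definition IP_star_plus (E : set nat) : Prop :=
  exists t : int, IP_star (translate E t).

(* Main.v *)
(* Every generalised polynomial of [N] is a function of any integral matrix [g]
   that brings [dil N W0] into a bounded fundamental domain, [W0] being a real
   point of a unipotent group graded by the dilations [dil m]; multiplying [N] by [m]
   acts by [dil m]. So [k ^ n \in E] becomes a sign pattern of entries of bounded
   matrices [W n] with [W (l + n)] in the integral orbit of [dil (k ^ l) (W n)].

   Let [n] tend to infinity along an idempotent ultrafilter, with limit [Wo], and let
   [a] run through an IP set along another one. By IP recurrence on nilmanifolds,
   [g_a (dil (1 + a) Wo)] tends to [Wo] for suitable integral [g_a]. The sign pattern of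
   [g_a (dil (1 + a) (W n))] is that of [W n] unless some leading coefficient vanishes
   at [Wo]. If it vanishes at [Wo] and at all nearby return times [k ^ l], the relation
   is graded and defined over the integers, and then it also vanishes at [a], being
   a small number that is integral after division by a power of [1 + a]. If it vanishes
   at [Wo] only, moving [Wo] along its orbit makes it nonzero. Hence
   [(1 + a) k ^ n \in E] for infinitely many [n]. *)

Require Import Defs.
From HB Require Import structures.
From mathcomp Require Import all_boot all_order all_algebra finmap.
From mathcomp Require Import boolp classical_sets functions cardinality reals.
From mathcomp Require Import filter.
From mathcomp Require Import zify ring lra.

Set Implicit Arguments.
Unset Strict Implicit.
Unset Printing Implicit Defensive.

Import Order.TTheory GRing.Theory Num.Theory.
Local Open Scope classical_set_scope.
Local Open Scope ring_scope.

(** * Idempotent ultrafilters *)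

(** Two kinds of sign are tracked at once. The inequalities that define the fundamental domain are
    signs of integral linear forms in the columns of [W n], and so is the condition [f = 0]: it says
    that one fractional part vanishes. Keeping the first kind shows that [g_a (dil (1 + a) (W n))]
    is again reduced, so that its columns do describe the point [(1 + a) k ^ n]; keeping the second
    shows that this point lies in [E].

    The obstacle is that such forms may vanish at [Wo], so that convergence to [Wo] decides nothing.
    What matters is how the columns of [W n] approach their limit. They are resolved once and for
    all into directions of decreasing size that serve every linear form, hence every pullback of a
    form by a return. Along one direction a pullback is a polynomial in [m], and a vanishing
    coefficient must be shown to stay exactly zero; approximation is not enough, whence the
    integrality and the grading.

    All returns near [Wo] then give one common sign. It is the original one because the powers
    [k ^ l] are such returns and merely turn [W n] into [W (l + n)]. *)

Definition idempotent (p : set_system nat) :=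
  forall A : set nat, p A -> \forall a \near p, \forall b \near p, A (a + b)%N.

(** For an ultrafilter [s], the closed set attached to this filter consists of the sums [t + s],
    with [t] in the closed set of [G]. *)
Definition sumf (G s : set_system nat) : set_system nat :=
  [set A | G [set a | s [set b | A (a + b)%N]]].

Lemma sumf_filter (G s : set_system nat) :
  ProperFilter G -> ProperFilter s -> ProperFilter (sumf G s).
Proof.
move=> FG Fs; apply: Build_ProperFilter_ex.
  move=> A GA; have [a sa] := @filter_ex _ G FG _ GA.
  by have [b Aab] := filter_ex sa; exists (a + b)%N.
split.
- by apply: (@filterS _ G _ setT) => [a _|]; exact: filterT.
- move=> A B GA GB; apply: (filterS _ (@filterI _ G _ _ _ GA GB)) => a [sA sB].
  exact: filterI.
- move=> A B AB GA; apply: (@filterS _ G _ _ _ _ GA) => a.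
  by apply: filterS => b; exact: AB.
Qed.

(* Closed subsets of the Stone-Cech compactification correspond to filters; this
   says that the closed set attached to [G] is a subsemigroup. *)
Definition subsemigroup (G : set_system nat) :=
  forall s, UltraFilter s -> G `<=` s -> G `<=` sumf G s.

(** Compactness of right translation by [s]. If a set [B] of [G] missed all [a] for which
    [A (a + b)] holds for [s]-most [b], then the complement of [A] would belong to [sumf G s], hence
    to [r]. *)
Lemma sumf_lift (G s r : set_system nat) :
  ProperFilter G -> UltraFilter s -> UltraFilter r -> sumf G s `<=` r ->
  exists t, [/\ UltraFilter t, G `<=` t &
    forall A, r A -> t [set a | s [set b | A (a + b)%N]]].
Proof.
move=> FG Us Ur Gr.
pose H := filter_from [set BA : set nat * set nat | G BA.1 /\ r BA.2]
  (fun BA => BA.1 `&` [set a | s [set b | BA.2 (a + b)%N]]).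
have FH : ProperFilter H.
  apply: filter_from_proper.
    apply: filter_from_filter.
      by exists (setT, setT); split; exact: filterT.
    move=> [B A] [B' A'] /= [GB rA] [GB' rA'].
    exists (B `&` B', A `&` A') => /=; first by split; exact: filterI.
    move=> a /= [[Ba B'a]] sAA'.
    by split; split => //; apply: filterS sAA' => b [].
  move=> [B A] /= [GB rA]; apply: contrapT => /forallNP noa.
  have : r (~` A).
    apply: Gr; apply: filterS GB => a Ba.
    have [sA|//] := in_ultra_setVsetC [set b | A (a + b)%N] Us.
    by case: (noa a).
  by move=> /(filterI rA) /filter_ex [x []].
have [t [Ut Ht]] := ultraFilterLemma FH.
exists t; split => //.
- move=> B GB; apply: Ht; exists (B, setT); first by split => //; exact: filterT.
  by move=> a [].
- move=> A rA; apply: Ht; exists (setT, A); first by split => //; exact: filterT.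
  by move=> a [].
Qed.

(** Rests on [(t1 + s) + (t2 + s) = (t1 + s + t2) + s]. *)
Lemma subsemigroup_sumf (G s : set_system nat) :
  ProperFilter G -> subsemigroup G -> UltraFilter s -> G `<=` s ->
  subsemigroup (sumf G s).
Proof.
move=> FG SG Us Gs r Ur Gr A GA.
have [t [Ut Gt rt]] := sumf_lift FG Us Ur Gr.
set B := [set a | s [set b | A (a + b)%N]].
have GB : G B by [].
have GBt := SG t Ut Gt B GB.
have GBts := SG s Us Gs _ GBt.
apply: (@filterS _ G _ _ _ _ GBts) => b; apply: filterS => a /= tBa.
have [//|rA] := in_ultra_setVsetC [set c | A (b + a + c)%N] Ur.
have [c [/= sA sA']] := filter_ex (@filterI _ t _ _ _ tBa (rt _ rA)).
have [d [/=]] := filter_ex (@filterI _ s _ _ _ sA sA').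
by rewrite addnA.
Qed.

(** The Ellis-Numakura argument read on filters: a maximal good filter is a minimal closed
    subsemigroup, and each of its points is idempotent. *)
Lemma ex_idempotent (F : set_system nat) : ProperFilter F ->
  (forall A, F A -> \forall a \near F, \forall b \near F, A (a + b)%N) ->
  exists p, [/\ UltraFilter p, F `<=` p & idempotent p].
Proof.
move=> FF SF.
pose good X := [/\ ProperFilter X, F `<=` X & subsemigroup X].
have goodF : good F.
  split=> // s Us Fs A /SF; apply: filterS => a; exact: Fs.
(* The value [set0] is allowed only to cover the union of an empty chain; it is not maximal, since
   [F] lies above it. *)
have [C FC totC|G [PG maxG]] :=
    @Zorn_bigcup _ [set X : set_system nat | X = set0 \/ good X].
  have [[X CX gX]|noX] := pselect (exists2 X, C X & good X); last first.
    left; rewrite -subset0 => A [X CX XA].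
    have [X0|gX] := FC X CX; first by rewrite X0 in XA.
    by case: noX; exists X.
  have gC Y A : C Y -> Y A -> good Y.
    by move=> CY YA; case: (FC Y CY) => // Y0; rewrite Y0 in YA.
  right; split.
  - apply: Build_ProperFilter_ex.
      move=> A [Y CY YA]; have [FY _ _] := gC _ _ CY YA; exact: filter_ex YA.
    split.
    + by exists X => //; have [FX _ _] := gX; exact: filterT.
    + move=> A B [Y CY YA] [Z CZ ZB].
      have [FY _ _] := gC _ _ CY YA; have [FZ _ _] := gC _ _ CZ ZB.
      have [YZ|ZY] := totC _ _ CY CZ.
      * by exists Z => //; apply: filterI => //; exact: YZ.
      * by exists Y => //; apply: filterI => //; exact: ZY.
    + move=> A B AB [Y CY YA]; exists Y => //.
      have [FY _ _] := gC _ _ CY YA; exact: filterS YA.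
  - by move=> A FA; exists X => //; have [_ FX _] := gX; exact: FX.
  - move=> s Us Cs A [Y CY YA]; have [FY _ SY] := gC _ _ CY YA.
    exists Y => //; apply: SY => //.
    by move=> B YB; apply: Cs; exists Y.
have gG : good G.
  case: PG => // G0; case: (maxG F); last by right.
  rewrite G0; split => // F0; exact: (F0 setT filterT).
have maxG' X : good X -> G `<=` X -> X `<=` G.
  move=> gX GX; apply: contrapT => nXG; apply: (maxG X); last by right.
  by split.
have [FG FsG SG] := gG.
have [s [Us Gs]] := ultraFilterLemma FG.
have GsG : sumf G s `<=` G.
  apply: maxG'; last exact: SG.
  split; first exact: sumf_filter.
  - by apply: subset_trans (SG s Us Gs).
  - exact: subsemigroup_sumf.
exists s; split=> //; first exact: subset_trans Gs.
(* The ultrafilters [t] containing [G] with [t + s = s] form a closed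
   subsemigroup, nonempty because [G + s = G]. *)
have [t [Ut Gt st]] := sumf_lift FG Us Us (subset_trans GsG Gs).
pose H := filter_from [set BA : set nat * set nat | G BA.1 /\ s BA.2]
  (fun BA => BA.1 `&` [set a | s [set b | BA.2 (a + b)%N]]).
have FH : Filter H.
  apply: filter_from_filter; first by exists (setT, setT); split; exact: filterT.
  move=> [B A] [B' A'] /= [GB rA] [GB' rA'].
  exists (B `&` B', A `&` A') => /=; first by split; exact: filterI.
  by move=> a /= [[Ba B'a]] sAA'; split; split => //; apply: filterS sAA' => b [].
have GH : G `<=` H.
  move=> B GB; exists (B, setT); first by split => //; exact: filterT.
  by move=> a [].
have sH A : s A -> H [set a | s [set b | A (a + b)%N]].
  move=> sA; exists (setT, A); first by split => //; exact: filterT.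
  by move=> a [].
have gH : good H.
  split; last 2 first.
  - exact: subset_trans GH.
  - move=> r Ur Hr B [[B0 A] /= [GB0 sA] sub].
    have GB0r := SG r Ur (subset_trans GH Hr) B0 GB0.
    apply: (@filterS _ H _ _ _ _ (@filterI _ H _ _ _ (GH _ GB0r) (sH _ sA))) => a [rB0 sAa].
    apply: (@filterS _ r _ _ _ _ (@filterI _ r _ _ _ rB0 (Hr _ (sH _ sAa)))).
    move=> b [B0b sAb]; apply: (sub (a + b)%N); split => //=.
    by apply: filterS sAb => c /=; rewrite addnA.
  - split => // -[[B A] /= [GB sA] sub].
    by have [x /sub] := filter_ex (@filterI _ t _ _ _ (Gt _ GB) (st _ sA)).
move=> A sA; apply: Gs; apply: (maxG' _ gH GH); exact: sH.
Qed.

(** * Limits along ultrafilters *)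

Lemma ultraVN (q : set_system nat) (P : nat -> Prop) : UltraFilter q ->
  (\forall n \near q, P n) \/ (\forall n \near q, ~ P n).
Proof. by move=> Uq; exact: in_ultra_setVsetC. Qed.

Lemma ultra_ex (q : set_system nat) (J : finType) (P : J -> nat -> Prop) :
  UltraFilter q -> (\forall n \near q, exists j, P j n) ->
  exists j, \forall n \near q, P j n.
Proof.
move=> Uq qP; apply: contrapT => /forallNP nP.
have : \forall n \near q, forall j, ~ P j n.
  by apply: filter_forall => j; case: (ultraVN (P j) Uq) => // /nP.
move=> qN; have [n [[j Pj] Nn]] := filter_ex (filterI qP qN).
exact: (Nn j).
Qed.

Section UltraLimits.
Variable R : realType.
Implicit Types (q : set_system nat) (f g : nat -> R) (l : R).

Variant ulim q f l : Prop :=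
  Ulim of forall e, 0 < e -> \forall n \near q, `|f n - l| < e.

Lemma ulimE q f l e : ulim q f l -> 0 < e -> \forall n \near q, `|f n - l| < e.
Proof. by case=> + e0; apply. Qed.

Lemma ulim_cst q l : Filter q -> ulim q (fun=> l) l.
Proof. by move=> Fq; split=> e e0; apply: nearW => n; rewrite subrr normr0. Qed.

Lemma ulim_near q f g l : Filter q -> (\forall n \near q, f n = g n) ->
  ulim q f l -> ulim q g l.
Proof.
by move=> Fq fg fl; split=> e /(ulimE fl); apply: filterS2 fg => n ->.
Qed.

Lemma ulim_ext q f g l l' : ulim q f l -> f =1 g -> l = l' -> ulim q g l'.
Proof. by move=> fl /funext <- <-. Qed.

Lemma ulim_unique q f l l' : ProperFilter q -> ulim q f l -> ulim q f l' ->
  l = l'.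
Proof.
move=> Fq fl fl'; apply/eqP; rewrite -subr_eq0 -normr_le0 leNgt; apply/negP => d0.
have e0 : 0 < `|l - l'| / 2 by rewrite divr_gt0.
have [n [h1 h2]] := filter_ex (filterI (ulimE fl e0) (ulimE fl' e0)).
suff : `|l - l'| < `|l - l'| by rewrite ltxx.
rewrite [ltRHS]splitr (le_lt_trans _ (ltrD h1 h2))// (distrC (f n) l).
by rewrite (le_trans _ (ler_normD _ _))// addrA subrK.
Qed.

Lemma ulimD q f g l l' : Filter q -> ulim q f l -> ulim q g l' ->
  ulim q (fun n => f n + g n) (l + l').
Proof.
move=> Fq fl gl; split=> e e0; have e20 : 0 < e / 2 by rewrite divr_gt0.
apply: filterS2 (ulimE fl e20) (ulimE gl e20) => n h1 h2.
by rewrite opprD addrACA (le_lt_trans (ler_normD _ _))// (splitr e) ltrD.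
Qed.

Lemma ulimZ q f l c : Filter q -> ulim q f l -> ulim q (fun n => c * f n) (c * l).
Proof.
move=> Fq fl; split=> e e0; have e20 : 0 < e / (`|c| + 1) by rewrite divr_gt0// ltr_wpDl.
apply: filterS (ulimE fl e20) => n h; rewrite -mulrBr normrM.
rewrite (le_lt_trans (_ : _ <= (`|c| + 1) * `|f n - l|))//.
  by rewrite ler_wpM2r// lerDl.
by rewrite mulrC -ltr_pdivlMr// ltr_wpDl.
Qed.

Lemma ulimM q f g l l' : Filter q -> ulim q f l -> ulim q g l' ->
  ulim q (fun n => f n * g n) (l * l').
Proof.
move=> Fq fl gl; split=> e e0.
have c0 : 0 < `|l| + `|l'| + 1 by rewrite ltr_wpDl// addr_ge0.
have d0 : 0 < Num.min 1 (e / (`|l| + `|l'| + 1)) by rewrite lt_min ltr01 divr_gt0.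
apply: filterS2 (ulimE fl d0) (ulimE gl d0) => n; set d := Num.min _ _ => h1 h2.
have -> : f n * g n - l * l' =
    (f n - l) * (g n - l') + (f n - l) * l' + l * (g n - l') by ring.
have d1 : d <= 1 by rewrite ge_min lexx.
rewrite (@lt_le_trans _ _ (d * (`|l| + `|l'| + 1)))//; last first.
  by rewrite -ler_pdivlMr// ge_min lexx orbT.
rewrite (le_lt_trans (ler_normD _ _))//.
have -> : d * (`|l| + `|l'| + 1) = (d * 1 + d * `|l'|) + `|l| * d by ring.
rewrite ltr_leD//; last by rewrite normrM ler_wpM2l// ltW.
rewrite (le_lt_trans (ler_normD _ _))// ltr_leD//.
  rewrite normrM (le_lt_trans (_ : _ <= `|f n - l| * 1))//.
    by rewrite ler_wpM2l// ltW// (lt_le_trans h2).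
  by rewrite !mulr1.
by rewrite normrM ler_wpM2r// ltW.
Qed.

Lemma ulim_sum q (J : finType) (f : J -> nat -> R) (l : J -> R) : Filter q ->
  (forall j, ulim q (f j) (l j)) -> ulim q (fun n => \sum_j f j n) (\sum_j l j).
Proof.
move=> Fq fl; rewrite -(@big_enum _ _ _ _ J)/=.
apply: (@ulim_near _ (fun n => \sum_(j <- enum J) f j n)).
  by apply: nearW => n; rewrite big_enum.
elim: (enum J) => [|j s IH].
  rewrite big_nil; apply: (@ulim_near _ (fun=> 0)); last exact: ulim_cst.
  by apply: nearW => n; rewrite big_nil.
rewrite big_cons; apply: (@ulim_near _ (fun n => f j n + \sum_(i <- s) f i n)).
  by apply: nearW => n; rewrite big_cons.
exact: ulimD.
Qed.

Lemma ulim_le q f l c : ProperFilter q -> ulim q f l ->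
  (\forall n \near q, f n <= c) -> l <= c.
Proof.
move=> Fq fl fc; rewrite leNgt; apply/negP => cl.
have lc : 0 < l - c by rewrite subr_gt0.
have [n [h1 h2]] := filter_ex (filterI (ulimE fl lc) fc).
by move: h1; rewrite ltr_norml => /andP[]; lra.
Qed.

Lemma ulim_sg q f l : Filter q -> ulim q f l -> l != 0 ->
  \forall n \near q, Num.sg (f n) = Num.sg l.
Proof.
move=> Fq fl l0; have l0' : 0 < `|l| by rewrite normr_gt0.
apply: filterS (ulimE fl l0') => n; rewrite ltr_norml => /andP[h1 h2].
case: (ltgtP l 0) l0 => // lp _.
  by rewrite !ltr0_sg//; move: h1 h2; rewrite ltr0_norm//; lra.
by rewrite !gtr0_sg//; move: h1 h2; rewrite gtr0_norm//; lra.
Qed.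

Lemma ulim_ex q f C : UltraFilter q -> (\forall n \near q, `|f n| <= C) ->
  exists l, ulim q f l.
Proof.
move=> Uq fC; pose A := [set x : R | \forall n \near q, x <= f n].
have AC : A (- C) by apply: filterS fC => n; rewrite ler_norml => /andP[].
have A_ub : ubound A C.
  move=> x Ax; have [n [h1]] := filter_ex (filterI Ax fC).
  by rewrite ler_norml => /andP[_]; exact: le_trans.
have sA : has_sup A by split; [exists (- C)|exists C].
exists (sup A); split=> e e0.
have [x Ax xe] := sup_adherent e0 sA.
have nA : ~ A (sup A + e).
  by move=> /(ub_le_sup (ex_intro _ C A_ub)); rewrite leNgt ltrDl e0.
have [//|qN] := ultraVN (fun n => sup A + e <= f n) Uq.
apply: filterS2 Ax qN => n h1 /negP; rewrite -ltNge => h2.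
by rewrite ltr_norml; apply/andP; split; lra.
Qed.

(** Only one integer can lie within less than 1/2 of the limit. *)
Lemma ultra_int_cst q (f : nat -> int) (C : R) : UltraFilter q ->
  (\forall n \near q, `|(f n)%:~R| <= C) -> exists z, \forall n \near q, f n = z.
Proof.
move=> Uq /(ulim_ex Uq) [l fl].
have h0 : (0 : R) < 2^-1 by rewrite invr_gt0.
have qf := ulimE fl h0.
have [m hm] := filter_ex qf; exists (f m); apply: filterS qf => n hn.
have : `|(f n - f m)%:~R| < (1 : R).
  rewrite rmorphB /=; have -> : (f n)%:~R - (f m)%:~R =
    ((f n)%:~R - l) - ((f m)%:~R - l) :> R by ring.
  by rewrite (le_lt_trans (ler_normB _ _))//; lra.
rewrite -intr_norm ltrz1 => h; lia.
Qed.

End UltraLimits.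

Section IdempotentLimits.
Variable R : realType.

(** The iterated limit of [f (a + b)], first in [b] and then in [a], equals the simple limit of [f].
    This makes the limits of the shifted orbits return to the base point. *)
Lemma idempotent_ulim (p : set_system nat) (f : nat -> R) (F : nat -> R) l :
  UltraFilter p -> idempotent p -> ulim p f l ->
  (forall a, ulim p (fun b => f (a + b)%N) (F a)) -> ulim p F l.
Proof.
move=> Up Ip fl Ff; split=> e e0.
have e20 : 0 < e / 2 by rewrite divr_gt0.
apply: filterS (Ip _ (ulimE fl e20)) => a h.
have [b [h1 h2]] := filter_ex (filterI h (ulimE (Ff a) e20)).
rewrite (splitr e); have -> : F a - l = (f (a + b)%N - l) - (f (a + b)%N - F a) by ring.
by rewrite (le_lt_trans (ler_normB _ _))// ltrD.
Qed.

End IdempotentLimits.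

(** * Admissible sequences *)

Section Rounding.
Variable R : realType.

(** The nearest integer rather than the integer part: it is locally constant near integers, on both
    sides. *)
Definition rnd (x : R) : int := Num.floor (x + 2^-1).

Lemma rnd_le (x : R) : `|x - (rnd x)%:~R| <= 2^-1.
Proof.
have := floor_le (x + 2^-1); have := floorD1_gt (x + 2^-1).
by rewrite -/(rnd x) intrD ler_norml => h1 h2; apply/andP; split; lra.
Qed.

Lemma int_near0 (z : int) : `|z%:~R| < (1 : R) -> z = 0.
Proof. rewrite -intr_norm ltrz1; lia. Qed.

End Rounding.

Section Admissible.
Variables (p : set_system nat).

(** The factor [u] is arbitrary because [b] goes to its limit first, with [a] fixed. Over an empty
    class only the zero function remains, so [Adm 1] below is additivity along [p]. *)
Inductive bispan (A : (nat -> int) -> Prop) : (nat -> nat -> int) -> Prop :=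
| span0 : bispan A (fun _ _ => 0)
| spanS (u v : nat -> int) (h : nat -> nat -> int) :
    A v -> bispan A h -> bispan A (fun a b => u a * v b + h a b).

(* Integer sequences without constant term, as in the theory of IP polynomials:
   the failure of additivity only involves functions of lower degree in [b]. *)
Fixpoint Adm (d : nat) (f : nat -> int) : Prop :=
  if d is d'.+1 then
    exists2 h, bispan (Adm d') h &
      \forall a \near p, \forall b \near p, f (a + b)%N = f a + f b + h a b
  else False.

Lemma span_ext A h h' : bispan A h -> (forall a b, h a b = h' a b) -> bispan A h'.
Proof.
by move=> Ah hh'; have <- : h = h' by apply/funext => a; apply/funext.
Qed.

Lemma span_mono (A B : (nat -> int) -> Prop) h :
  (forall v, A v -> B v) -> bispan A h -> bispan B h.
Proof.
by move=> AB; elim=> [|u v h' Av _ IH]; [exact: span0|apply: spanS => //; exact: AB].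
Qed.

Lemma spanD A h h' : bispan A h -> bispan A h' -> bispan A (fun a b => h a b + h' a b).
Proof.
move=> + Ah'; elim=> [|u v h0 Av _ IH].
  by apply: span_ext Ah' _ => a b; rewrite add0r.
by apply: (span_ext (spanS u Av IH)) => a b; rewrite addrA.
Qed.

Lemma spanZ A (c : nat -> int) h : bispan A h -> bispan A (fun a b => c a * h a b).
Proof.
elim=> [|u v h0 Av _ IH]; first by apply: (span_ext (span0 A)) => a b; rewrite mulr0.
by apply: (span_ext (spanS (fun a => c a * u a) Av IH)) => a b; ring.
Qed.

Lemma span1 (A : (nat -> int) -> Prop) u v : A v -> bispan A (fun a b => u a * v b).
Proof.
by move=> Av; apply: (span_ext (spanS u Av (span0 A))) => a b; rewrite addr0.
Qed.

Lemma spanM (A B : (nat -> int) -> Prop) (g : nat -> int) h :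
  (forall v, A v -> B (fun b => v b * g b)) -> bispan A h ->
  bispan B (fun a b => h a b * g b).
Proof.
move=> AB; elim=> [|u v h0 Av _ IH].
  by apply: (span_ext (span0 B)) => a b; rewrite mul0r.
apply: (span_ext (spanS u (AB _ Av) IH)) => a b; ring.
Qed.

Lemma spanMM (A B C : (nat -> int) -> Prop) h h' :
  (forall v w, A v -> B w -> C (fun b => v b * w b)) -> bispan A h -> bispan B h' ->
  bispan C (fun a b => h a b * h' a b).
Proof.
move=> ABC Ah Bh'; elim: Ah => [|u v h0 Av _ IH].
  by apply: (span_ext (span0 C)) => a b; rewrite mul0r.
have : bispan C (fun a b => u a * (h' a b * v b)).
  apply/spanZ/(spanM _ Bh') => w Bw.
  have -> : (fun b => w b * v b) = (fun b => v b * w b).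
    by apply/funext => b; rewrite mulrC.
  exact: ABC.
move=> /spanD/(_ IH)/span_ext; apply => a b; ring.
Qed.

Hypothesis Up : UltraFilter p.

Lemma AdmS d f : Adm d f -> Adm d.+1 f.
Proof.
elim: d f => [//|d IH] f [h Ah fh]; exists h => //.
by apply: span_mono Ah.
Qed.

Lemma Adm_leq d e f : (d <= e)%N -> Adm d f -> Adm e f.
Proof.
move=> /subnK <-; elim: (e - d)%N => [//|n IH] /IH; rewrite addSn; exact: AdmS.
Qed.

Lemma Adm_add d f g : Adm d f -> Adm d g -> Adm d (fun a => f a + g a).
Proof.
case: d => [//|d] [h Ah fh] [h' Ah' gh']; exists (fun a b => h a b + h' a b).
  exact: spanD.
apply: filterS2 fh gh' => a ha ha'; apply: filterS2 ha ha' => b -> ->; ring.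
Qed.

(** Each cross term of [f (a + b) * g (a + b)] has a factor in [b] of degree less than [d + e],
    which the induction on [d + e] handles. *)
Lemma Adm_mul d e f g : Adm d f -> Adm e g -> Adm (d + e) (fun a => f a * g a).
Proof.
have [n] := ubnP (d + e); elim: n => // n IH in d e f g *.
case: d e => [//|d] [//|e]; rewrite ltnS => le_n Af Ag.
have [h Ah fh] := Af; have [h' Ah' gh'] := Ag.
have {}IH d' e' f' g' : (d' + e' <= d + e.+1)%N -> Adm d' f' -> Adm e' g' ->
    Adm (d + e.+1) (fun a => f' a * g' a).
  move=> le Af' Ag'; apply: (Adm_leq le); apply: IH => //; lia.
exists (fun a b => f a * g b + (g a * f b + (f a * h' a b + (h' a b * f b +
  (g a * h a b + (h a b * g b + h a b * h' a b)))))).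
  apply: spanD; first by apply: span1; apply: Adm_leq Ag; lia.
  apply: spanD; first by apply: span1; apply: Adm_leq Af; lia.
  apply: spanD.
    by apply: spanZ; apply: span_mono Ah' => v; apply: Adm_leq; lia.
  apply: spanD; first by apply: spanM Ah' => v Av; apply: IH Av Af; lia.
  apply: spanD.
    by apply: spanZ; apply: span_mono Ah => v; apply: Adm_leq; lia.
  apply: spanD; first by apply: spanM Ah => v Av; apply: IH Av Ag; lia.
  by apply: spanMM Ah Ah' => v w Av Aw; apply: IH Av Aw; lia.
apply: filterS2 fh gh' => a ha ha'; apply: filterS2 ha ha' => b -> ->; ring.
Qed.

Definition adm f := exists d, Adm d f.

Lemma adm_ext f g : adm f -> (forall a, f a = g a) -> adm g.
Proof. by move=> Af fg; have <- : f = g by apply/funext. Qed.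

Lemma admD f g : adm f -> adm g -> adm (fun a => f a + g a).
Proof.
move=> [d Af] [e Ag]; exists (maxn d e).
by apply: Adm_add; [apply: Adm_leq Af|apply: Adm_leq Ag]; lia.
Qed.

Lemma admM f g : adm f -> adm g -> adm (fun a => f a * g a).
Proof. by move=> [d Af] [e Ag]; exists (d + e)%N; exact: Adm_mul. Qed.

Lemma adm_additive f : (forall a b, f (a + b)%N = f a + f b) -> adm f.
Proof.
move=> fD; exists 1%N, (fun _ _ => 0); first exact: span0.
by apply: nearW => a; apply: nearW => b; rewrite addr0.
Qed.

Lemma adm0 : adm (fun=> 0).
Proof. by apply: adm_additive => a b; rewrite addr0. Qed.

Lemma adm_id : adm (fun a => a%:Z).
Proof. by apply: adm_additive => a b; rewrite PoszD. Qed.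

Lemma admZ c f : adm f -> adm (fun a => c * f a).
Proof.
move=> [[//|d] [h Ah fh]]; exists d.+1, (fun a b => c * h a b); first exact: spanZ.
apply: filterS fh => a; apply: filterS => b ->; ring.
Qed.

Lemma adm_sum (J : finType) (P : pred J) (f : J -> nat -> int) :
  (forall j, P j -> adm (f j)) -> adm (fun a => \sum_(j | P j) f j a).
Proof.
move=> Af; elim: (index_enum J) => [|j s IH].
  by apply: adm_ext adm0 _ => a; rewrite big_nil.
case: (boolP (P j)) => Pj; last first.
  by apply: adm_ext IH _ => a; rewrite big_cons (negPf Pj).
by apply: adm_ext (admD (Af _ Pj) IH) _ => a; rewrite big_cons Pj.
Qed.

Variable R : realType.
Hypothesis Ip : idempotent p.

Definition small (f : nat -> int) := forall th : R,
  ulim p (fun a => (f a)%:~R * th - (rnd ((f a)%:~R * th))%:~R) 0.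

(** For fixed [a] the coefficients are fixed integers, so approximations of the [v b * th] by
    integers add up. The class [B] is left free so that [h'] can later be given the degree needed in
    [adm_rnd]. *)
Lemma span_small A h (r : (nat -> int) -> nat -> int) (th : R) :
  (forall v, A v -> ulim p (fun b => (v b)%:~R * th - (r v b)%:~R) 0) ->
  bispan A h -> exists2 h', (forall B, (forall v, A v -> B (r v)) -> bispan B h') &
  forall a, ulim p (fun b => (h a b)%:~R * th - (h' a b)%:~R) 0.
Proof.
move=> rA; elim=> [|u v h0 Av _ [h' Ah' hh']].
  exists (fun _ _ => 0) => [B _|a']; first exact: span0.
  by apply: (ulim_ext (ulim_cst 0 _)) => // b; rewrite mul0r subrr.
exists (fun a b => u a * r v b + h' a b) => [B AB|a'].
  by apply: spanS; [exact: AB|exact: Ah'].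
apply: (ulim_ext (ulimD _ (ulimZ (u a')%:~R _ (rA _ Av)) (hh' a'))).
  by move=> b; rewrite !rmorphD !rmorphM /=; ring.
by rewrite mulr0 addr0.
Qed.

(** The remainder has a limit [l] with [|l| <= 1/2]. Comparing [a], [b] and [a + b] by idempotence
    gives [l = l + l] modulo 1, the defect [h] being negligible by induction; so [l] is an integer,
    namely 0. *)
Lemma Adm_small d f : Adm d f -> small f.
Proof.
elim: d f => [//|d IH] f [h Ah fh] th.
set g := fun a => _ - _.
have gb a : `|g a| <= 2^-1 by exact: rnd_le.
have [l gl] := ulim_ex Up (nearW _ gb).
suff <- : l = 0 by [].
have [h' _ hh'] : exists2 h' : nat -> nat -> int, True &
    forall a, ulim p (fun b => (h a b)%:~R * th - (h' a b)%:~R) 0.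
  have [h' _ hh'] := span_small (th := th)
    (r := fun v b => rnd ((v b)%:~R * th)) (fun v Av => IH v Av th) Ah.
  by exists h'.
have lb : `|l| <= 2^-1.
  rewrite ler_norml; apply/andP; split.
    rewrite -lerN2 opprK -mulN1r.
    apply: (ulim_le _ (ulimZ (-1) _ gl)); apply: nearW => n.
    by have := gb n; rewrite ler_norml => /andP[]; lra.
  by apply: (ulim_le _ gl); apply: nearW => n; have := gb n; rewrite ler_norml => /andP[].
apply/eqP/negPn/negP => l0.
have l0' : 0 < `|l| by rewrite normr_gt0.
(* Four errors below [e] place the integer [z] within [|l| / 2] of [l]; then [|z| < 1], so [z = 0],
   which is too far from [l]. *)
pose e := `|l| / 8; have e0 : 0 < e by rewrite divr_gt0.
have qe := ulimE gl e0.
have [a [[qa qab] fa]] := filter_ex (filterI (filterI qe (Ip qe)) fh).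
have [b [[qb qab'] [fab hab]]] :=
  filter_ex (filterI (filterI qe qab) (filterI fa (ulimE (hh' a) e0))).
move: qab'; rewrite /g fab !rmorphD /= => qab'.
pose z := rnd ((f (a + b)%N)%:~R * th) - rnd ((f a)%:~R * th) -
          rnd ((f b)%:~R * th) - h' a b.
have zl : `|z%:~R - l| < 4 * e.
  rewrite /z !rmorphB /=; move: qab' qa qb hab; rewrite /g fab !rmorphD /=.
  by rewrite !ltr_norml => /andP[? ?] /andP[? ?] /andP[? ?] /andP[? ?];
     apply/andP; split; lra.
have z0 : z = 0.
  apply: (@int_near0 R).
  have : `|z%:~R| <= `|z%:~R - l| + `|l|.
    by rewrite -{1}(subrK l z%:~R) ler_normD.
  by move=> h0; apply: le_lt_trans h0 _; rewrite /e in zl; lra.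
by move: zl; rewrite z0 sub0r normrN /e; lra.
Qed.

Lemma adm_small f : adm f -> small f.
Proof. by move=> [d]; exact: Adm_small. Qed.

(** The remainders at [a], [b], [a + b] and that of the defect are each below 1/4, so the integer by
    which rounding fails to match the rounded defect is 0. *)
Lemma adm_rnd f (th : R) : adm f -> adm (fun a => rnd ((f a)%:~R * th)).
Proof.
move=> [d Af]; exists d; elim: d f Af => [//|d IH] f Af.
have sf := Adm_small Af th; have [h Ah fh] := Af.
have [h' Ah' hh'] := span_small (th := th)
  (r := fun v b => rnd ((v b)%:~R * th)) (fun v Av => Adm_small Av th) Ah.
exists h'; first by apply: Ah' => v /IH.
have e0 : (0 : R) < 4^-1 by rewrite invr_gt0.
have qe := ulimE sf e0.
apply: filterS (filterI (filterI qe (Ip qe)) fh) => a [[qa qab] fa].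
apply: filterS (filterI (filterI qe qab) (filterI fa (ulimE (hh' a) e0))).
move=> b [[qb qab'] [fab hab]].
apply/eqP; rewrite -subr_eq0; apply/eqP; apply: (@int_near0 R).
move: qab' qa qb hab; rewrite fab !subr0 rmorphB !rmorphD /=.
by rewrite !ltr_norml => /andP[? ?] /andP[? ?] /andP[? ?] /andP[? ?];
   apply/andP; split; lra.
Qed.

End Admissible.

(** * Graded matrices *)

Section FiniteMatrices.
Variables (K : comNzRingType) (I : finType) (om : I -> nat).
Implicit Types (A B : I -> I -> K) (u x y : I -> K).

Definition dot u x : K := \sum_i u i * x i.
Definition app A x : I -> K := fun i => \sum_j A i j * x j.
Definition mulf A B : I -> I -> K := fun i j => \sum_k A i k * B k j.
Definition idf : I -> I -> K := fun i j => (i == j)%:R.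
(** Conjugation by the diagonal matrix of the [m ^ om i]. The truncated subtraction is harmless on
    matrices satisfying [shape], and it keeps integral matrices integral. *)
Definition dil (m : nat) A : I -> I -> K :=
  fun i j => m%:R ^+ (om i - om j) * A i j.
Definition dilv (m : nat) x : I -> K := fun i => m%:R ^+ om i * x i.
Definition wpart (w : nat) x : I -> K := fun i => if om i == w then x i else 0.
Definition shape A := forall i j, (om i < om j)%N -> A i j = 0.

Lemma dotD u x y : dot u (fun i => x i + y i) = dot u x + dot u y.
Proof. by rewrite /dot -big_split; apply: eq_bigr => i _; rewrite mulrDr. Qed.

Lemma dotZ u c x : dot u (fun i => c * x i) = c * dot u x.
Proof. by rewrite /dot mulr_sumr; apply: eq_bigr => i _; rewrite mulrCA. Qed.

Lemma dotB u x y : dot u (fun i => x i - y i) = dot u x - dot u y.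
Proof.
have -> : (fun i => x i - y i) = (fun i => x i + (- 1) * y i).
  by apply/funext => i; rewrite mulN1r.
by rewrite dotD dotZ mulN1r.
Qed.

Lemma dot_sum (J : finType) (P : pred J) u (x : J -> I -> K) :
  dot u (fun i => \sum_(j | P j) x j i) = \sum_(j | P j) dot u (x j).
Proof.
rewrite /dot exchange_big /=; apply: eq_bigr => i _.
by rewrite mulr_sumr.
Qed.

Lemma dot_app u A x : dot u (app A x) = dot (fun j => \sum_i u i * A i j) x.
Proof.
rewrite /dot /app; under eq_bigr do rewrite mulr_sumr.
rewrite exchange_big /=; apply: eq_bigr => j _; rewrite mulr_suml.
by apply: eq_bigr => i _; rewrite mulrA.
Qed.

Lemma appD A x y : app A (fun i => x i + y i) = (fun i => app A x i + app A y i).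
Proof.
by apply/funext => i; rewrite /app -big_split; apply: eq_bigr => j _; rewrite mulrDr.
Qed.

Lemma appZ A c x : app A (fun i => c * x i) = (fun i => c * app A x i).
Proof.
by apply/funext => i; rewrite /app mulr_sumr; apply: eq_bigr => j _; rewrite mulrCA.
Qed.

Lemma appB A x y : app A (fun i => x i - y i) = (fun i => app A x i - app A y i).
Proof.
apply/funext => i; rewrite /app -sumrB; apply: eq_bigr => j _.
by rewrite mulrBr.
Qed.

Lemma app_sum (J : finType) (P : pred J) A (x : J -> I -> K) :
  app A (fun i => \sum_(j | P j) x j i) = (fun i => \sum_(j | P j) app A (x j) i).
Proof.
apply/funext => i; rewrite /app exchange_big /=; apply: eq_bigr => j _.
by rewrite mulr_sumr.
Qed.

Lemma app_mulf A B x : app (mulf A B) x = app A (app B x).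
Proof.
apply/funext => i; rewrite /app /mulf.
under eq_bigr do rewrite mulr_suml.
rewrite exchange_big /=; apply: eq_bigr => k _; rewrite mulr_sumr.
by apply: eq_bigr => j _; rewrite mulrA.
Qed.

Lemma app_idf x : app idf x = x.
Proof.
apply/funext => i; rewrite /app (bigD1 i)//= /idf eqxx mul1r big1 ?addr0// => j ji.
by rewrite eq_sym (negPf ji) mul0r.
Qed.

Lemma mulfA A B C : mulf A (mulf B C) = mulf (mulf A B) C.
Proof.
by apply/funext => i; apply/funext => j;
  exact: esym (congr1 (fun f => f i) (app_mulf A B (fun k => C k j))).
Qed.

Lemma mulf1 A : mulf A idf = A.
Proof.
apply/funext => i; apply/funext => j; rewrite /mulf (bigD1 j)//= /idf eqxx mulr1.
by rewrite big1 ?addr0// => k /negPf ->; rewrite mulr0.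
Qed.

Lemma shape_dil m A : shape A -> shape (dil m A).
Proof. by move=> sA i j ij; rewrite /dil sA// mulr0. Qed.

Lemma dilM m A B : shape A -> shape B ->
  dil m (mulf A B) = mulf (dil m A) (dil m B).
Proof.
move=> sA sB; apply/funext => i; apply/funext => j; rewrite /dil /mulf mulr_sumr.
apply: eq_bigr => k _; rewrite mulrACA -exprD.
case: (ltnP (om i) (om k)) => ik; first by rewrite sA// !(mul0r, mulr0).
case: (ltnP (om k) (om j)) => kj; first by rewrite sB// !mulr0.
by congr (_ ^+ _ * _); lia.
Qed.

Lemma dil_dil m n A : dil m (dil n A) = dil (m * n) A.
Proof.
by apply/funext => i; apply/funext => j; rewrite /dil mulrA -exprMn natrM.
Qed.

Lemma dil_idf m : dil m idf = idf.
Proof.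
apply/funext => i; apply/funext => j; rewrite /dil /idf.
by case: eqP => [->|_]; rewrite ?mulr0// subnn mul1r.
Qed.

Lemma app_dil m A x : shape A -> app (dil m A) (dilv m x) = dilv m (app A x).
Proof.
move=> sA; apply/funext => i; rewrite /app /dil /dilv mulr_sumr.
apply: eq_bigr => j _; rewrite mulrACA -exprD.
case: (ltnP (om i) (om j)) => ij; first by rewrite sA// !(mul0r, mulr0).
by rewrite subnK// mulrA.
Qed.

Lemma dilv_dilv m n x : dilv m (dilv n x) = dilv (m * n) x.
Proof. by apply/funext => i; rewrite /dilv mulrA -exprMn natrM. Qed.

Lemma dilv_comp m w x : dilv m (wpart w x) = (fun i => m%:R ^+ w * wpart w x i).
Proof.
apply/funext => i; rewrite /dilv /wpart; case: eqP => [->//|_].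
by rewrite !mulr0.
Qed.

Lemma comp_sum d x : (forall i, (om i < d)%N) ->
  x = (fun i => \sum_(w < d) wpart w x i).
Proof.
move=> omd; apply/funext => i; rewrite (bigD1 (Ordinal (omd i)))//= /wpart eqxx.
by rewrite big1 ?addr0// => w /negPf; rewrite -val_eqE/= eq_sym => ->.
Qed.

End FiniteMatrices.

Definition toR (R : realType) (I : Type) (A : I -> I -> int) : I -> I -> R :=
  fun i j => (A i j)%:~R.

Lemma toR_mulf (R : realType) (I : finType) (A B : I -> I -> int) :
  toR R (mulf A B) = mulf (toR R A) (toR R B).
Proof.
apply/funext => i; apply/funext => j; rewrite /toR /mulf rmorph_sum.
by apply: eq_bigr => k _; rewrite rmorphM.
Qed.

Lemma toR_idf (R : realType) (I : finType) : toR R (@idf int I) = @idf R I.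
Proof. by apply/funext => i; apply/funext => j; rewrite /toR /idf; case: eqP. Qed.

Lemma toR_dil (R : realType) (I : finType) (om : I -> nat) m (A : I -> I -> int) :
  toR R (dil om m A) = dil om m (toR R A).
Proof.
by apply/funext => i; apply/funext => j; rewrite /toR /dil rmorphM rmorphXn /= natz.
Qed.

Lemma shape_toR (R : realType) (I : finType) (om : I -> nat) (A : I -> I -> int) :
  shape om A -> shape om (toR R A).
Proof. by move=> sA i j ij; rewrite /toR sA. Qed.

(** * Integral coordinates of real vectors, and asymptotic signs of linear forms *)

Section Scales.
Variable R : realType.

(** A generating family of least length is independent: a relation with [a j0 != 0] eliminates
    [t j0] once the other generators are divided by [a j0], which keeps the coordinates integral. *)
Lemma int_basis (I : finType) (x : I -> R) :
  exists s (t : 'I_s -> R) (z : 'I_s -> I -> int),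
    (forall i, x i = \sum_j (z j i)%:~R * t j) /\
    (forall a : 'I_s -> int, \sum_j (a j)%:~R * t j = 0 -> forall j, a j = 0).
Proof.
pose P s := `[< exists (t : 'I_s -> R) (z : 'I_s -> I -> int),
  forall i, x i = \sum_j (z j i)%:~R * t j >].
have exP : exists s, P s.
  exists #|I|; apply/asboolP.
  exists (fun j => x (enum_val j)), (fun j i => (enum_val j == i)%:R) => i.
  rewrite (bigD1 (enum_rank i))//= enum_rankK eqxx mul1r big1 ?addr0// => j ji.
  have [ei|] := eqVneq (enum_val j) i; last by rewrite mul0r.
  by rewrite -ei enum_valK eqxx in ji.
case: (ex_minnP exP) => s /asboolP[t [z xz]] smin.
exists s, t, z; split => // a at0 j0; apply/eqP/negPn/negP => a0.
case: s => [|s] in t z xz smin a at0 j0 a0 *; first by case: j0 a0.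
suff /smin : P s by rewrite ltnn.
have a0R : (a j0)%:~R != 0 :> R by rewrite intr_eq0.
apply/asboolP; exists (fun j => t (lift j0 j) / (a j0)%:~R).
exists (fun j i => z (lift j0 j) i * a j0 - z j0 i * a (lift j0 j)) => i.
rewrite xz (bigD1_ord j0)//=.
have {at0} : (a j0)%:~R * t j0 = - \sum_j (a (lift j0 j))%:~R * t (lift j0 j).
  by move: at0; rewrite (bigD1_ord j0)//= => /eqP; rewrite addr_eq0 => /eqP.
move=> /(canRL (mulKf a0R)) ->.
rewrite mulrN mulrN mulr_sumr mulr_sumr -sumrN -big_split; apply: eq_bigr => j _ /=.
by rewrite rmorphB !rmorphM /=; field.
Qed.

Fixpoint lexsg (s : seq R) : R :=
  if s is x :: s' then if x == 0 then lexsg s' else Num.sg x else 0.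

(* The values [w n] are compared along [q] scale by scale: the vectors in [rs]
   are the successive directions of [w n], ordered by decreasing magnitude. *)
Lemma scales (q : set_system nat) (I : finType) (w : nat -> I -> R) :
  UltraFilter q -> exists rs : seq (I -> R), forall u : I -> R,
    \forall n \near q, Num.sg (dot u (w n)) = lexsg [seq dot u r | r <- rs].
Proof.
move=> Uq.
suff : forall (A : {set I}) w, (forall n i, i \notin A -> w n i = 0) ->
    exists rs : seq (I -> R), forall u : I -> R,
    \forall n \near q, Num.sg (dot u (w n)) = lexsg [seq dot u r | r <- rs].
  by move=> /(_ [set: I]%SET w); apply => n i; rewrite inE.
move=> {}A {}w; have [c] := ubnP #|A|; elim: c => // c IH in A w * => /ltnSE-Ac wA.
have [w0|wN] := ultraVN (fun n => forall i, w n i = 0) Uq.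
  exists [::] => u; apply: filterS w0 => n wn.
  by rewrite /dot big1 ?sgr0// => i _; rewrite wn mulr0.
have [i0 i0P] : exists i0, \forall n \near q,
    w n i0 != 0 /\ forall i, `|w n i| <= `|w n i0|.
  apply: ultra_ex; apply: filterS wN => n /existsNP [i1 /eqP wi1].
  case: (@Order.TotalTheory.arg_maxP _ _ _ i1 predT (fun i => `|w n i|)) => // j _ jP.
  exists j; split; last by move=> i; exact: jP.
  by rewrite -normr_gt0 (lt_le_trans _ (jP i1 _))// normr_gt0.
have i0A : i0 \in A.
  have [n [wn _]] := filter_ex i0P.
  by apply/negPn/negP => /(wA n)/eqP; rewrite (negPf wn).
have [sg0 sg0P] : exists b : bool, \forall n \near q, (0 < w n i0) = b.
  apply: (ultra_ex (P := fun b n => (0 < w n i0) = b)).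
  by apply: nearW => n; exists (0 < w n i0).
have : forall i, exists l, ulim q (fun n => w n i / w n i0) l.
  move=> i; apply: (@ulim_ex _ _ _ 1); apply: filterS i0P => n [wn0 /(_ i)].
  by rewrite normrM normfV ler_pdivrMr ?normr_gt0// mul1r.
move=> /choice [r rP].
have r0 : r i0 = 1.
  apply: (ulim_unique _ (rP i0)); apply: ulim_near (ulim_cst _ _) => //.
  by apply: filterS i0P => n [wn0 _]; rewrite divff.
have rA i : i \notin A -> r i = 0.
  move=> iA; apply: (ulim_unique _ (rP i)); apply: (ulim_ext (ulim_cst 0 _)) => // n.
  by rewrite wA// mul0r.
(* Subtracting the dominant direction kills the coordinate [i0], since [r i0 = 1]; a form that
   vanishes on [r] takes the same values on [w'] as on [w]. *)
pose w' n i := w n i - w n i0 * r i.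
have [|n i|rs rsP] := IH (A :\ i0)%SET w'.
- by move: Ac; rewrite (cardsD1 i0) i0A.
- rewrite !inE negb_and negbK => /orP[/eqP ->|iA]; rewrite /w'.
    by rewrite r0 mulr1 subrr.
  by rewrite wA// rA// mulr0 subrr.
exists ((fun i => (if sg0 then 1 else -1) * r i) :: rs) => u /=.
rewrite dotZ; case: ifPn => [/eqP ru|ru].
  have {}ru : dot u r = 0.
    by apply/eqP; move/eqP: ru; case: (sg0); rewrite ?mul1r// mulN1r oppr_eq0.
  apply: filterS (rsP u) => n; rewrite /w' => <-.
  by rewrite dotB dotZ ru mulr0 subr0.
have {}ru : dot u r != 0 by apply: contra ru => /eqP ->; rewrite mulr0.
have : ulim q (fun n => dot u (fun i => w n i / w n i0)) (dot u r).
  by apply: ulim_sum => i; apply: ulimZ; exact: rP.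
move=> /ulim_sg/(_ ru) sgq.
apply: filterS (filterI (filterI sgq i0P) sg0P) => n [[sgn [wn0 _]] sg0n].
have -> : w n = (fun i => w n i0 * (w n i / w n i0)).
  by apply/funext => i; rewrite mulrCA divff// mulr1.
rewrite dotZ !sgrM sgn -sg0n.
by case: (ltgtP (w n i0) 0) wn0 => // h _; rewrite ?(gtr0_sg h) ?(ltr0_sg h) ?sgrN ?sgr1.
Qed.

(** The highest nonzero [b w] dominates for large [m]. The coefficients above it must vanish exactly
    in [a] too, as a tiny one could be amplified by its power of [m]. *)
Lemma sg_poly_stable d (b : nat -> R) : exists eta m0 s, 0 < eta /\
  forall (m : nat) (a : nat -> R), (m0 <= m)%N ->
    (forall w, (w < d)%N -> `|a w - b w| < eta) ->
    (forall w, (w < d)%N -> b w = 0 -> a w = 0) ->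
    Num.sg (\sum_(w < d) m%:R ^+ w * a w) = s.
Proof.
elim: d => [|d [eta [m0 [s [eta0 IH]]]]].
  by exists 1, 0%N, 0; split=> // m a _ _ _; rewrite big_ord0 sgr0.
have [bd|bd] := eqVneq (b d) 0.
  exists eta, m0, s; split=> // m a mm0 ab a0; rewrite big_ord_recr/= a0//.
  rewrite mulr0 addr0; apply: IH => // w wd; first by apply: ab; exact: ltnW.
  by apply: a0; exact: ltnW.
pose S := \sum_(w < d) (`|b w| + 1).
have S0 : 0 <= S by apply: sumr_ge0 => w _; rewrite addr_ge0.
have bd0 : 0 < `|b d| by rewrite normr_gt0.
exists (Num.min 1 (`|b d| / 2)), (Num.bound (2 * S / `|b d|)).+1, (Num.sg (b d)).
split; first by rewrite lt_min ltr01 divr_gt0.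
move=> m a mm0 ab _.
have mge : 2 * S / `|b d| < m%:R.
  rewrite (lt_le_trans (archi_boundP _))//; first by rewrite divr_ge0// mulr_ge0.
  by rewrite ler_nat; apply: ltnW.
have m0' : 0 < m%:R :> R by rewrite ltr0n; lia.
have h1 : `|\sum_(w < d) m%:R ^+ w * a w| <= m%:R ^+ d.-1 * S.
  rewrite (le_trans (ler_norm_sum _ _ _))// /S mulr_sumr; apply: ler_sum => w _.
  rewrite normrM ler_pM//.
    rewrite ger0_norm ?exprn_ge0// ?ler0n// ler_weXn2l//; first by rewrite ler1n; lia.
    by have := ltn_ord w; lia.
  have := ab w (ltnW (ltn_ord w)); rewrite lt_min => /andP[h _].
  rewrite -(subrK (b w) (a w)) addrC (le_trans (ler_normD _ _))//.
  by rewrite lerD2l ltW.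
have h2 : `|a d - b d| < `|b d| / 2.
  by have := ab d (ltnSn d); rewrite lt_min => /andP[].
have {h1} h1 : `|\sum_(w < d) m%:R ^+ w * a w| < m%:R ^+ d * (`|b d| / 2).
  case: d => [|d] in S S0 bd bd0 mge h1 {mm0 h2 ab IH} *.
    by rewrite big_ord0 normr0 mulr_gt0// ?expr0// divr_gt0.
  rewrite (le_lt_trans h1)//= exprS -mulrA mulrCA ltr_pM2l ?exprn_gt0//.
  by move: mge; rewrite ltr_pdivrMr//; lra.
rewrite big_ord_recr/= -(subrK (m%:R ^+ d * b d) (_ + _)).
set X := _ - _.
have hX : `|X| < m%:R ^+ d * `|b d|.
  have -> : X = \sum_(w < d) m%:R ^+ w * a w + m%:R ^+ d * (a d - b d).
    by rewrite /X; ring.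
  rewrite (le_lt_trans (ler_normD _ _))//.
  have -> : m%:R ^+ d * `|b d| = m%:R ^+ d * (`|b d| / 2) + m%:R ^+ d * (`|b d| / 2).
    by rewrite -mulrDr -splitr.
  rewrite ltrD// normrM (ger0_norm (_ : 0 <= m%:R ^+ d)) ?exprn_ge0// ?ltr_pM2l//.
  exact: exprn_gt0.
have mb0 : 0 < m%:R ^+ d * `|b d| by rewrite mulr_gt0// exprn_gt0.
move: hX; rewrite ltr_norml => /andP[hX1 hX2].
case: (ltgtP (b d) 0) bd => // bs _.
  rewrite ltr0_norm// in hX1 hX2; rewrite !ltr0_sg//; lra.
by rewrite gtr0_norm// in hX1 hX2; rewrite !gtr0_sg//; lra.
Qed.

Lemma unif_eta (J : finType) (P : J -> R -> Prop) :
  (forall j e e', e' <= e -> P j e -> P j e') ->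
  (forall j, exists2 e, 0 < e & P j e) ->
  exists2 e, 0 < e & forall j, P j e.
Proof.
move=> Pm jP; have /choice [e eP] : forall j, exists e, 0 < e /\ P j e.
  by move=> j; have [e e0 Pe] := jP j; exists e.
exists (\big[Num.min/1]_j e j).
  by elim/big_ind: _ => // [x y x0 y0|j _]; [rewrite lt_min x0|case: (eP j)].
move=> j; have [_ /Pm] := eP j; apply.
by rewrite (bigD1 j)//= ge_min lexx.
Qed.

End Scales.

(** * Stability of signs along return times *)

Section LimitsOfMatrices.
Variables (R : realType) (I : finType) (q : set_system nat).
Hypothesis Fq : Filter q.

Lemma ulim_dot (u : I -> R) (x : nat -> I -> R) y :
  (forall i, ulim q (fun n => x n i) (y i)) ->
  ulim q (fun n => dot u (x n)) (dot u y).
Proof. by move=> xy; apply: ulim_sum => i; apply: ulimZ; exact: xy. Qed.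

Lemma ulim_app (A : nat -> I -> I -> R) B (x : nat -> I -> R) y :
  (forall i j, ulim q (fun n => A n i j) (B i j)) ->
  (forall i, ulim q (fun n => x n i) (y i)) ->
  forall i, ulim q (fun n => app (A n) (x n) i) (app B y i).
Proof. by move=> AB xy i; apply: ulim_sum => j; apply: ulimM. Qed.

Lemma ulim_mulf (A B : nat -> I -> I -> R) A0 B0 :
  (forall i j, ulim q (fun n => A n i j) (A0 i j)) ->
  (forall i j, ulim q (fun n => B n i j) (B0 i j)) ->
  forall i j, ulim q (fun n => mulf (A n) (B n) i j) (mulf A0 B0 i j).
Proof. by move=> AA0 BB0 i j; apply: ulim_sum => k; apply: ulimM. Qed.

Lemma ulimX (f : nat -> R) l e : ulim q f l -> ulim q (fun n => f n ^+ e) (l ^+ e).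
Proof.
move=> fl; elim: e => [|e IH]; first exact: ulim_cst.
by apply: (ulim_ext (ulimM _ fl IH)) => [n|]; rewrite exprS.
Qed.

Lemma ulim_inv_pow k : (1 < k)%N -> (forall m, \forall n \near q, (m <= n)%N) ->
  ulim q (fun l => (k ^ l)%:R^-1) (0 : R).
Proof.
move=> k1 qinf; split => e e0.
apply: filterS (qinf (Num.bound e^-1)) => n hn.
have kn : (n < k ^ n)%N by exact: ltn_expl.
have kn0 : (0 : R) < (k ^ n)%:R by rewrite ltr0n; lia.
rewrite subr0 ger0_norm ?invr_ge0 ?ler0n// invf_plt ?posrE//.
have e10 : 0 <= e^-1 by rewrite invr_ge0 ltW.
apply: (lt_le_trans (archi_boundP e10)).
by rewrite ler_nat (leq_trans hn)// ltnW.
Qed.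

End LimitsOfMatrices.

Lemma dot_app_close (R : realType) (I : finType) (u x : I -> R) (A B : I -> I -> R) e :
  (forall i j, `|A i j - B i j| < e) ->
  `|dot u (app A x) - dot u (app B x)| <= e * \sum_i \sum_j `|u i| * `|x j|.
Proof.
move=> AB; rewrite -dotB /dot (le_trans (ler_norm_sum _ _ _))// mulr_sumr.
apply: ler_sum => i _; rewrite /app -sumrB normrM mulr_sumr.
rewrite (le_trans (ler_wpM2l (normr_ge0 _) (ler_norm_sum _ _ _)))// mulr_sumr.
apply: ler_sum => j _; rewrite -mulrBl normrM.
have := ltW (AB i j) => h.
have -> : e * (`|u i| * `|x j|) = `|u i| * (e * `|x j|) by ring.
by rewrite ler_wpM2l// ler_wpM2r.
Qed.

Section Dilation.
Variables (K : comNzRingType) (I : finType) (om : I -> nat).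

Lemma dilvB m (x y : I -> K) :
  dilv om m (fun i => x i - y i) = (fun i => dilv om m x i - dilv om m y i).
Proof. by apply/funext => i; rewrite /dilv mulrBr. Qed.

Lemma comp_dilv m w (x : I -> K) : wpart om w (dilv om m x) = dilv om m (wpart om w x).
Proof.
by apply/funext => i; rewrite /wpart /dilv; case: eqP => // _; rewrite mulr0.
Qed.

Lemma dot_dilv_comp (u : I -> K) A m w x :
  dot u (app A (dilv om m (wpart om w x))) = m%:R ^+ w * dot u (app A (wpart om w x)).
Proof. by rewrite dilv_comp appZ dotZ. Qed.

Lemma app_supp (A : I -> I -> K) w x : shape om A ->
  (forall i, (om i < w)%N -> x i = 0) -> forall i, (om i < w)%N -> app A x i = 0.
Proof.
move=> sA x0 i iw; rewrite /app big1// => j _.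
case: (ltnP (om j) w) => jw; first by rewrite x0// mulr0.
by rewrite sA ?mul0r// (leq_trans iw).
Qed.

End Dilation.

Section Recurrence.
Variables (R : realType) (I : finType) (om : I -> nat) (k : nat).
Variable q : set_system nat.
Hypotheses (k1 : (1 < k)%N) (Uq : UltraFilter q) (Iq : idempotent q).
Hypothesis qinf : forall m, \forall n \near q, (m <= n)%N.
Variables (W V : nat -> I -> I -> R) (g : nat -> nat -> I -> I -> int).
Hypotheses (shW : forall n, shape om (W n)) (shV : forall n, shape om (V n)).
Hypotheses (WV : forall n, mulf (W n) (V n) = idf R (I := I))
           (VW : forall n, mulf (V n) (W n) = idf R (I := I)).
Hypothesis Wg : forall l n, W (l + n) = mulf (toR R (g l n)) (dil om (k ^ l) (W n)).
Variables (Wl : nat -> I -> I -> R) (Vo : I -> I -> R) (gl : nat -> I -> I -> int).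
Hypothesis Wlq : forall l i j, ulim q (fun n => W (l + n) i j) (Wl l i j).
Hypothesis Voq : forall i j, ulim q (fun n => V n i j) (Vo i j).
Hypothesis glq : forall l, \forall n \near q, g l n = gl l.

Let Wo := Wl 0.

Lemma Wl_cvg i j : ulim q (fun l => Wl l i j) (Wo i j).
Proof. by apply: (idempotent_ulim Uq Iq (Wlq 0 i j)) => a; exact: Wlq. Qed.

Lemma Wl_shape l : shape om (Wl l).
Proof.
move=> i j ij; apply: (ulim_unique _ (Wlq l i j)).
by apply: (ulim_ext (ulim_cst 0 _)) => // n; rewrite shW.
Qed.

Lemma Vo_shape : shape om Vo.
Proof.
move=> i j ij; apply: (ulim_unique _ (Voq i j)).
by apply: (ulim_ext (ulim_cst 0 _)) => // n; rewrite shV.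
Qed.

Lemma WVo : mulf Wo Vo = idf R (I := I).
Proof.
apply/funext => i; apply/funext => j.
apply: (ulim_unique _ (ulim_mulf _ (Wlq 0) Voq i j)).
by apply: (ulim_ext (ulim_cst (idf R i j) _)) => // n; rewrite WV.
Qed.

Lemma VWo : mulf Vo Wo = idf R (I := I).
Proof.
apply/funext => i; apply/funext => j.
apply: (ulim_unique _ (ulim_mulf _ Voq (Wlq 0) i j)).
by apply: (ulim_ext (ulim_cst (idf R i j) _)) => // n; rewrite VW.
Qed.

Lemma Wl_shift l' :
  \forall l \near q, Wl (l' + l) = mulf (toR R (gl l')) (dil om (k ^ l') (Wl l)).
Proof.
apply: filterS (Iq (glq l')) => l gll.
apply/funext => i; apply/funext => j; apply: (ulim_unique _ (Wlq (l' + l) i j)).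
apply: (@ulim_near _ _ (fun n => mulf (toR R (gl l')) (dil om (k ^ l') (W (l + n))) i j)).
  by apply: filterS gll => n gn; rewrite -addnA (Wg l') gn.
apply: ulim_mulf => i' j'; first exact: ulim_cst.
by apply: ulimZ; exact: Wlq.
Qed.

Lemma WlE l : Wl l = mulf (toR R (gl l)) (dil om (k ^ l) Wo).
Proof.
apply/funext => i; apply/funext => j; apply: (ulim_unique _ (Wlq l i j)).
apply: (@ulim_near _ _ (fun n => mulf (toR R (gl l)) (dil om (k ^ l) (W n)) i j)).
  by apply: filterS (glq l) => n gn; rewrite Wg gn.
apply: ulim_mulf => i' j'; first exact: ulim_cst.
by apply: ulimZ; exact: (Wlq 0).
Qed.

Lemma app_Wl l x :
  app (Wl l) (dilv om (k ^ l) x) =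
  app (toR R (gl l)) (dilv om (k ^ l) (app Wo x)).
Proof. by rewrite WlE app_mulf app_dil//; exact: Wl_shape. Qed.

Lemma Wl_comp_lim (u x : I -> R) :
  (\forall l \near q, dot u (app (Wl l) x) = 0) -> dot u (app Wo x) = 0.
Proof.
move=> ux; apply: (@ulim_unique _ q (fun l => dot u (app (Wl l) x))).
  apply: ulim_dot => i; apply: ulim_app => [i' j'|i']; first exact: Wl_cvg.
  exact: ulim_cst.
apply: (@ulim_near _ _ (fun=> 0)); last exact: ulim_cst.
by apply: filterS ux => n ->.
Qed.

(* A relation holding along the return times is graded: dividing by the power of
   [k ^ l] of the top weight and letting [l] tend to infinity isolates the leading
   part of [x]. *)
Lemma graded_relation (u : I -> R) d x : (forall i, (d <= om i)%N -> x i = 0) ->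
  (\forall l \near q, dot u (app (Wl l) (dilv om (k ^ l) x)) = 0) ->
  forall w, \forall l \near q, dot u (app (Wl l) (wpart om w x)) = 0.
Proof.
elim: d x => [|d IH] x x0 ux w.
  apply: nearW => l; have -> : wpart om w x = (fun i => 0 * x i).
    by apply/funext => i; rewrite /wpart x0// if_same mul0r.
  by rewrite appZ dotZ mul0r.
have kl0 l : (k ^ l)%:R != 0 :> R by rewrite pnatr_eq0 expn_eq0; lia.
have top : \forall l \near q, dot u (app (Wl l) (wpart om d x)) = 0.
  (* Here [l'] stays fixed and the relation is used at [l' + l]. As [l] grows, the rescaled vector
     [xl l] tends to the part of weight [d] and [Wl l] tends to [Wo], which leaves the relation for
     that part at [l']. *)
  apply: filterS (Iq ux) => l' ul'.
  suff : dot u (app (Wl l') (dilv om (k ^ l') (wpart om d x))) = 0.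
    rewrite dot_dilv_comp => /eqP.
    by rewrite mulf_eq0 expf_eq0 (negPf (kl0 l')) andbF => /eqP.
  rewrite app_Wl.
  pose xl l := fun i => (k ^ l)%:R^-1 ^+ d * dilv om (k ^ l) x i.
  apply: (@ulim_unique _ q
    (fun l => dot u (app (toR R (gl l')) (dilv om (k ^ l') (app (Wl l) (xl l)))))).
    apply: ulim_dot => i; apply: ulim_app => [i' j'|i']; first exact: ulim_cst.
    apply: ulimZ; apply: ulim_app => [i1 j1|i1]; first exact: Wl_cvg.
    rewrite /wpart /xl /dilv; case: (ltngtP (om i1) d) => i1d.
    - have Fq : Filter q by exact: _.
      have := ulimZ (x i1) Fq (ulimX Fq (d - om i1)%N (ulim_inv_pow R Fq k1 qinf)).
      rewrite expr0n subn_eq0 leqNgt i1d mulr0 => xlim.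
      apply: (ulim_ext xlim) => // l.
      rewrite -(subnKC (ltnW i1d)) exprD addKn mulrACA.
      by rewrite -exprMn mulVf// expr1n mul1r mulrC.
    - by rewrite x0//; apply: (ulim_ext (ulim_cst 0 _)) => // l; rewrite !mulr0.
    - apply: (ulim_ext (ulim_cst (x i1) _)) => // l.
      by rewrite i1d mulrA -exprMn mulVf// expr1n mul1r.
  apply: (@ulim_near _ _ (fun=> 0)); last exact: ulim_cst.
  apply: filterS2 ul' (Wl_shift l') => l ul Wll.
  rewrite /xl appZ; set c := _ ^+ d.
  have -> : dilv om (k ^ l') (fun i => c * app (Wl l) (dilv om (k ^ l) x) i) =
      (fun i => c * dilv om (k ^ l') (app (Wl l) (dilv om (k ^ l) x)) i).
    by apply/funext => i; rewrite /dilv mulrCA.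
  rewrite appZ dotZ -app_dil; last exact: Wl_shape.
  by rewrite -app_mulf -Wll dilv_dilv -expnD ul mulr0.
have [->//|wd] := eqVneq w d.
pose x' := fun i => x i - wpart om d x i.
have -> : wpart om w x = wpart om w x'.
  apply/funext => i; rewrite /wpart /x' /wpart; case: eqP => // ->.
  by rewrite (negPf wd) subr0.
apply: IH.
  move=> i; rewrite leq_eqVlt /x' /wpart => /orP[/eqP <-|di]; first by rewrite eqxx subrr.
  by rewrite x0// if_same subrr.
apply: filterS2 ux top => l ul tl.
by rewrite dilvB appB dotB ul dot_dilv_comp tl mulr0 subr0.
Qed.

Definition close (e : R) (m : nat) (h : I -> I -> int) :=
  forall i j, `|mulf (toR R h) (dil om m Wo) i j - Wo i j| < e.

Definition relation (u xi : I -> R) :=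
  \forall l \near q, dot u (app (toR R (gl l)) (dilv om (k ^ l) xi)) = 0.

Lemma close_le e e' m h : e' <= e -> close e' m h -> close e m h.
Proof. by move=> ee ce i j; rewrite (lt_le_trans (ce i j)). Qed.

Lemma app_h m h (x : I -> R) :
  app (toR R h) (dilv om m (app Wo x)) =
  app (mulf (toR R h) (dil om m Wo)) (dilv om m x).
Proof. by rewrite app_mulf app_dil//; exact: Wl_shape. Qed.

Lemma relation_comp u d x : (forall i, (om i < d)%N) ->
  relation u (app Wo x) -> forall w,
  (\forall l \near q, dot u (app (Wl l) (wpart om w x)) = 0) /\
  dot u (app Wo (wpart om w x)) = 0.
Proof.
move=> omd ux w.
have ul : \forall l \near q, dot u (app (Wl l) (wpart om w x)) = 0.
  apply: (@graded_relation _ d) => [i|]; first by rewrite leqNgt omd.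
  by apply: filterS ux => l; rewrite app_Wl.
by split=> //; exact: Wl_comp_lim.
Qed.

Lemma comp_relation u w x :
  (\forall l \near q, dot u (app (Wl l) (wpart om w x)) = 0) ->
  relation u (app Wo (wpart om w x)).
Proof.
by apply: filterS => l ul; rewrite -app_Wl dot_dilv_comp ul mulr0.
Qed.

(* An integral vector [z] of weights [>= w] satisfying the relation: its leading
   part contributes [m ^ w] times a small number, while the total is an integral
   multiple of [m ^ w]. *)
Lemma rigid_int (c : I -> int) d w (z : I -> int) (u := fun i => (c i)%:~R : R) :
  (forall i, (om i < d)%N) ->
  (forall i, (om i < w)%N -> z i = 0) ->
  relation u (fun i => (z i)%:~R) ->
  (forall xi, (forall i, (om i < w.+1)%N -> xi i = 0) -> relation u xi ->
    exists2 e, 0 < e & forall m h, (0 < m)%N -> close e m h ->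
      dot u (app (toR R h) (dilv om m xi)) = 0) ->
  exists2 e, 0 < e & forall m h, (0 < m)%N -> close e m h ->
    dot u (app (toR R h) (dilv om m (fun i => (z i)%:~R))) = 0.
Proof.
move=> omd z0 uz IH; pose x := app Vo (fun i => (z i)%:~R).
have Wx : app Wo x = (fun i => (z i)%:~R) by rewrite -app_mulf WVo app_idf.
have ux : relation u (app Wo x) by rewrite Wx.
have [ulw u0] := relation_comp omd ux w.
pose x' := fun i => x i - wpart om w x i.
have [||e1 e10 e1P] := IH (app Wo x').
- apply: app_supp; first exact: Wl_shape.
  move=> i; rewrite ltnS leq_eqVlt /x' /wpart => /orP[/eqP ->|iw].
    by rewrite eqxx subrr.
  rewrite (ltn_eqF iw) subr0; apply: app_supp iw; first exact: Vo_shape.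
  by move=> j jw; rewrite z0.
- apply: filterS2 ux ulw => l; rewrite -!app_Wl => ul ul'.
  by rewrite dilvB appB dotB ul dot_dilv_comp ul' mulr0 subr0.
pose S := \sum_i \sum_j `|u i| * `|wpart om w x j|.
have S0 : 0 <= S by apply: sumr_ge0 => i _; apply: sumr_ge0 => j _; rewrite mulr_ge0.
have S10 : 0 < (S + 1)^-1 by rewrite invr_gt0 ltr_wpDl.
(* With this bound the leading part differs from its value 0 at [Wo] by at most [S / (S + 1)], which
   is below 1. *)
exists (Num.min e1 (S + 1)^-1) => [|m h m0 cl]; first by rewrite lt_min e10.
have cl1 : close e1 m h by apply: close_le cl; rewrite ge_min lexx.
have cl2 : close (S + 1)^-1 m h by apply: close_le cl; rewrite ge_min lexx orbT.
pose z' := fun i => m%:Z ^+ (om i - w) * z i.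
have mw0 : 0 < m%:R ^+ w :> R by rewrite exprn_gt0// ltr0n.
have E1 : dot u (app (toR R h) (dilv om m (fun i => (z i)%:~R))) =
    m%:R ^+ w * (dot c (app h z'))%:~R.
  have -> : dilv om m (fun i => (z i)%:~R) = (fun i => m%:R ^+ w * (z' i)%:~R : R).
    apply/funext => i; rewrite /dilv /z' rmorphM rmorphXn /= mulrA.
    case: (ltnP (om i) w) => iw; first by rewrite z0// !mulr0.
    by rewrite -exprD subnKC.
  rewrite appZ dotZ; congr (_ * _); rewrite /dot rmorph_sum; apply: eq_bigr => i _.
  rewrite rmorphM /=; congr (_ * _); rewrite /app rmorph_sum.
  by apply: eq_bigr => j _; rewrite [RHS]rmorphM.
have E2 : dot u (app (toR R h) (dilv om m (fun i => (z i)%:~R))) =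
    m%:R ^+ w * dot u (app (mulf (toR R h) (dil om m Wo)) (wpart om w x)).
  rewrite -Wx.
  have -> : app Wo x = (fun i => app Wo (wpart om w x) i + app Wo x' i).
    rewrite -appD; congr app; apply/funext => i; rewrite /x'; ring.
  have -> : dilv om m (fun i => app Wo (wpart om w x) i + app Wo x' i) =
      (fun i => dilv om m (app Wo (wpart om w x)) i + dilv om m (app Wo x') i).
    by apply/funext => i; rewrite /dilv mulrDr.
  by rewrite appD dotD e1P// addr0 app_h dot_dilv_comp.
have := dot_app_close u (wpart om w x) cl2; rewrite u0 subr0 -/S => small.
suff E0 : dot c (app h z') = 0 by rewrite E1 E0 mulr0.
apply: (@int_near0 R).
have -> : (dot c (app h z'))%:~R =
    dot u (app (mulf (toR R h) (dil om m Wo)) (wpart om w x)).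
  by apply: (mulfI (lt0r_neq0 mw0)); rewrite -E1 E2.
by rewrite (le_lt_trans small)// mulrC ltr_pdivrMr ?mul1r ?ltrDl// ltr_wpDl.
Qed.

(** Over an independent family [t], a relation for the real vector [xi] splits into relations for
    the integral vectors [z j], to which [rigid_int] applies. The induction descends on the lowest
    weight [w] that may occur in [xi]. *)
Lemma rigid (c : I -> int) d (u := fun i => (c i)%:~R : R) xi :
  (forall i, (om i < d)%N) -> relation u xi ->
  exists2 e, 0 < e & forall m h, (0 < m)%N -> close e m h ->
    dot u (app (toR R h) (dilv om m xi)) = 0.
Proof.
move=> omd uxi.
suff : forall r w xi, (d <= w + r)%N -> (forall i, (om i < w)%N -> xi i = 0) ->
    relation u xi -> exists2 e, 0 < e & forall m h, (0 < m)%N -> close e m h ->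
    dot u (app (toR R h) (dilv om m xi)) = 0.
  by move=> /(_ d 0%N xi); apply.
elim=> [|r IH] w {uxi}xi dwr xi0 uxi.
  exists 1 => // m h _ _; have -> : xi = (fun i => 0 * xi i).
    by apply/funext => i; rewrite mul0r xi0// (leq_trans (omd i))// -(addn0 w).
  have -> : dilv om m (fun i => 0 * xi i) = (fun i => 0 * xi i).
    by apply/funext => i; rewrite /dilv !mul0r mulr0.
  by rewrite appZ dotZ mul0r.
have [s [t [z [xiz tfree]]]] := int_basis xi.
have sumz (B : I -> I -> int) m : dot u (app (toR R B) (dilv om m xi)) =
    \sum_j (dot c (app B (fun i => m%:Z ^+ om i * z j i)))%:~R * t j.
  have -> : dilv om m xi = (fun i => \sum_j t j * (m%:R ^+ om i * (z j i)%:~R)).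
    apply/funext => i; rewrite /dilv xiz mulr_sumr; apply: eq_bigr => j _; ring.
  rewrite app_sum dot_sum; apply: eq_bigr => j _; rewrite appZ dotZ mulrC.
  congr (_ * _); rewrite /dot rmorph_sum; apply: eq_bigr => i _.
  rewrite rmorphM /=; congr (_ * _); rewrite /app rmorph_sum.
  by apply: eq_bigr => a _; rewrite [RHS]rmorphM [in RHS]rmorphM [in RHS]rmorphXn.
have int_dot (B : I -> I -> int) m j :
    dot u (app (toR R B) (dilv om m (fun i => (z j i)%:~R))) =
    (dot c (app B (fun i => m%:Z ^+ om i * z j i)))%:~R.
  rewrite /dot rmorph_sum; apply: eq_bigr => i _.
  rewrite rmorphM /=; congr (_ * _); rewrite /app rmorph_sum.
  by apply: eq_bigr => a _; rewrite [RHS]rmorphM [in RHS]rmorphM [in RHS]rmorphXn.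
have zj j : exists2 e, 0 < e & forall m h, (0 < m)%N -> close e m h ->
    dot u (app (toR R h) (dilv om m (fun i => (z j i)%:~R))) = 0.
  apply: (rigid_int omd (w := w)).
  - by move=> i iw; apply: (tfree (fun j => z j i)); rewrite -xiz xi0.
  - apply: filterS uxi => l; rewrite sumz => ul; rewrite int_dot.
    by rewrite (tfree (fun j => dot c (app _ (fun i => _ * z j i))) ul j).
  - by move=> xi'; apply: IH; rewrite addSnnS.
have [|e e0 eP] := unif_eta _ zj.
  by move=> j e e' ee eP m h m0 cl; apply: eP => //; exact: close_le cl.
exists e => // m h m0 cl; rewrite sumz big1// => j _.
by rewrite -int_dot eP// mul0r.
Qed.

(* Each weight component of [r] is either nonzero at the base point or vanishes at
   all nearby return times; a shift of the base point along the orbit ensures it. *)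
Definition generic (u r : I -> R) := forall w,
  let y := wpart om w (app Vo r) in
  dot u (app Wo y) != 0 \/ \forall l \near q, dot u (app (Wl l) y) = 0.

Definition pullback (u : I -> R) (m : nat) (h : I -> I -> int) : I -> R :=
  fun j => (\sum_i u i * (h i j)%:~R) * m%:R ^+ om j.

Lemma dot_row u m h x : dot (pullback u m h) x = dot u (app (toR R h) (dilv om m x)).
Proof. by rewrite dot_app /dot; apply: eq_bigr => j _; rewrite mulrA. Qed.

(** The pullback takes on [r] a value polynomial in [m], whose coefficient of [m ^ w] is close to
    the one at [Wo]. Where the latter is 0, genericity and [rigid] make the former exactly 0, so
    [sg_poly_stable] applies. *)
Lemma generic_sg (c : I -> int) (u := fun i => (c i)%:~R : R) r : generic u r ->
  exists e m0 s, 0 < e /\ forall m h, (m0 <= m)%N -> close e m h ->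
    Num.sg (dot (pullback u m h) r) = s.
Proof.
move=> ur; pose x := app Vo r.
have Wx : app Wo x = r by rewrite -app_mulf WVo app_idf.
pose d := (\max_i om i).+1.
have omd i : (om i < d)%N by rewrite ltnS leq_bigmax.
pose b w := dot u (app Wo (wpart om w x)).
have [e1 [m1 [s [e10 sP]]]] := sg_poly_stable d b.
have [||e2 e20 e2P] := @unif_eta R 'I_d (fun w e => b w = 0 ->
    forall m h, (0 < m)%N -> close e m h ->
    dot u (app (toR R h) (dilv om m (app Wo (wpart om w x)))) = 0).
- by move=> j e e' ee eP bj m h m0 cl; apply: eP => //; exact: close_le cl.
- move=> w; have [bw|bw] := eqVneq (b w) 0; last first.
    by exists 1 => // bw0; rewrite bw0 eqxx in bw.
  have [|uw] := ur w; first by rewrite -/x -/(b w) bw eqxx.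
  have [e e0 eP] := rigid omd (comp_relation uw).
  by exists e => // _.
pose S := \sum_(w < d) \sum_i \sum_j `|u i| * `|wpart om w x j|.
have S0 (w : 'I_d) : 0 <= \sum_i \sum_j `|u i| * `|wpart om w x j|.
  by apply: sumr_ge0 => i _; apply: sumr_ge0 => j _; rewrite mulr_ge0.
have SS0 : 0 <= S by apply: sumr_ge0 => w _.
have S10 : 0 < e1 / (S + 1) by rewrite divr_gt0// ltr_wpDl.
exists (Num.min e2 (e1 / (S + 1))), m1.+1, s; split; first by rewrite lt_min e20.
move=> m h mm cl; have m0 : (0 < m)%N by lia.
have cl1 : close e2 m h by apply: close_le cl; rewrite ge_min lexx.
have cl2 : close (e1 / (S + 1)) m h by apply: close_le cl; rewrite ge_min lexx orbT.
have mw0 w : m%:R ^+ w != 0 :> R by rewrite expf_neq0// pnatr_eq0; lia.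
pose a w := dot u (app (mulf (toR R h) (dil om m Wo)) (wpart om w x)).
rewrite dot_row -Wx app_h.
have -> : dilv om m x = (fun i => \sum_(w < d) m%:R ^+ w * wpart om w x i).
  rewrite {1}(comp_sum x omd); apply/funext => i; rewrite /dilv mulr_sumr.
  by apply: eq_bigr => w _; rewrite /wpart; case: eqP => [->|_]; rewrite ?mulr0.
rewrite app_sum dot_sum.
under eq_bigr do rewrite appZ dotZ.
apply: (sP m a) => [|w wd|w wd bw]; first exact: ltnW.
  have := dot_app_close u (wpart om w x) cl2; rewrite -/(b w) -/(a w) => h1.
  apply: (le_lt_trans h1).
  have : \sum_i \sum_j `|u i| * `|wpart om w x j| <= S.
    by rewrite /S (bigD1 (Ordinal wd))//= lerDl sumr_ge0.
  move=> /(ler_wpM2l (ltW S10)) h2; apply: (le_lt_trans h2).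
  by rewrite -mulrA gtr_pMr// mulrC ltr_pdivrMr ?mul1r ?ltrDl// ltr_wpDl.
have := e2P (Ordinal wd) bw m h m0 cl1; rewrite app_h dot_dilv_comp => /eqP.
by rewrite mulf_eq0 (negPf (mw0 w)) => /eqP.
Qed.

Lemma generic_lexsg (c : I -> int) (u := fun i => (c i)%:~R : R) rs :
  (forall a, (a < size rs)%N -> generic u (nth (fun=> 0) rs a)) ->
  exists e m0 s, 0 < e /\ forall m h, (m0 <= m)%N -> close e m h ->
    lexsg [seq dot (pullback u m h) r | r <- rs] = s.
Proof.
elim: rs => [|r rs IH] urs; first by exists 1, 0%N, 0.
have [e1 [m1 [s1 [e10 s1P]]]] := generic_sg (urs 0%N isT).
have [|e2 [m2 [s2 [e20 s2P]]]] := IH; first by move=> a; exact: (urs a.+1).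
exists (Num.min e1 e2), (maxn m1 m2), (if s1 == 0 then s2 else s1).
split=> [|m h]; first by rewrite lt_min e10.
rewrite geq_max => /andP[mm1 mm2] cl /=.
have cl1 : close e1 m h by apply: close_le cl; rewrite ge_min lexx.
have cl2 : close e2 m h by apply: close_le cl; rewrite ge_min lexx orbT.
by rewrite s2P// -(s1P m h mm1 cl1) sgr_eq0.
Qed.

Lemma sg_col u m h n j : (0 < m)%N ->
  Num.sg (dot u (fun i => mulf (toR R h) (dil om m (W n)) i j)) =
  Num.sg (dot (pullback u m h) (fun i => W n i j)).
Proof.
move=> m0; have mj0 : 0 < m%:R ^+ om j :> R by rewrite exprn_gt0// ltr0n.
rewrite dot_row -[LHS]mul1r -(gtr0_sg mj0) -sgrM -dotZ; congr (Num.sg (dot _ _)).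
apply/funext => i; rewrite /mulf /app mulr_sumr; apply: eq_bigr => a _.
rewrite mulrCA; congr (_ * _); rewrite /dil /dilv mulrA -exprD.
case: (ltnP (om a) (om j)) => aj; first by rewrite shW// !mulr0.
by rewrite subnKC.
Qed.

Lemma stable_sg (c : I -> int) (u := fun i => (c i)%:~R : R) j rs :
  (forall v : I -> R, \forall n \near q,
    Num.sg (dot v (fun i => W n i j)) = lexsg [seq dot v r | r <- rs]) ->
  (forall a, (a < size rs)%N -> generic u (nth (fun=> 0) rs a)) ->
  exists e m0, 0 < e /\ forall m h, (m0 <= m)%N -> close e m h ->
    \forall n \near q,
      Num.sg (dot u (fun i => mulf (toR R h) (dil om m (W n)) i j)) =
      Num.sg (dot u (fun i => W n i j)).
Proof.
move=> rsP /generic_lexsg [e [m0 [s [e0 sP]]]].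
have sgP m h : (m0.+1 <= m)%N -> close e m h -> \forall n \near q,
    Num.sg (dot u (fun i => mulf (toR R h) (dil om m (W n)) i j)) = s.
  move=> mm cl; apply: filterS (rsP (pullback u m h)) => n sn.
  by rewrite sg_col; [rewrite sn sP// ltnW|lia].
exists e, m0.+1; split=> // m h mm cl.
have qW := rsP u; set s' := lexsg _ in qW.
(* The two signs are compared on the return [k ^ l] with matrix [gl l]: it is close along [q], so
   its sign is [s]; it carries [W n] to [W (l + n)], whose sign is [s'] by idempotence. *)
suff ss' : s = s' by apply: filterS2 (sgP m h mm cl) qW => n -> ->.
have clq : \forall l \near q, close e (k ^ l) (gl l).
  apply: filter_forall => i'; apply: filter_forall => j'.
  apply: filterS (ulimE (Wl_cvg i' j') e0) => l.
  by rewrite WlE.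
have [l [[cll ml] ql]] := filter_ex (filterI (filterI clq (qinf m0.+1)) (Iq qW)).
have kl : (m0.+1 <= k ^ l)%N by rewrite (leq_trans ml)// ltnW// ltn_expl.
have [n [[h1 h2] h3]] := filter_ex (filterI (filterI (sgP _ _ kl cll) ql) (glq l)).
by rewrite -h1 -h2 Wg h3.
Qed.

End Recurrence.

Lemma ex_matrix_limit (R : realType) (I : finType) (q : set_system nat) (C : R)
    (A : nat -> I -> I -> R) : UltraFilter q -> (forall n i j, `|A n i j| <= C) ->
  exists B, forall i j, ulim q (fun n => A n i j) (B i j).
Proof.
move=> Uq AC; have /choice [B BP] : forall ij : I * I, exists l,
    ulim q (fun n => A n ij.1 ij.2) l.
  by move=> ij; apply: ulim_ex; apply: nearW => n; exact: AC.
by exists (fun i j => B (i, j)) => i j; exact: (BP (i, j)).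
Qed.

(** Solving for [g n] gives [W (l + n)] times the dilate of [V n], which is bounded for fixed [l]; a
    bounded integral matrix is constant along [q]. *)
Lemma ex_g_limit (R : realType) (I : finType) (om : I -> nat) (k l : nat)
    (q : set_system nat) (W V : nat -> I -> I -> R) (g : nat -> I -> I -> int) (C : R) :
  UltraFilter q -> (forall n, shape om (W n)) -> (forall n, shape om (V n)) ->
  (forall n, mulf (W n) (V n) = idf R (I := I)) ->
  (forall n, W (l + n) = mulf (toR R (g n)) (dil om (k ^ l) (W n))) ->
  (forall n i j, `|W n i j| <= C) -> (forall n i j, `|V n i j| <= C) ->
  exists gl, \forall n \near q, g n = gl.
Proof.
move=> Uq shW shV WV Wg WC VC.
have gE n : toR R (g n) = mulf (W (l + n)) (dil om (k ^ l) (V n)).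
  by rewrite Wg -mulfA -dilM// WV dil_idf mulf1.
have /choice [B BP] : forall ij : I * I, exists z, \forall n \near q, g n ij.1 ij.2 = z.
  move=> [i j]; apply: (@ultra_int_cst R _ _
    (\sum_a C * ((k ^ l)%:R ^+ (om a - om j) * C))) => //; apply: nearW => n /=.
  rewrite -[_%:~R]/(toR R (g n) i j) gE (le_trans (ler_norm_sum _ _ _))//.
  apply: ler_sum => a _; rewrite normrM ler_pM// /dil normrM ler_pM//.
  by rewrite ger0_norm ?exprn_ge0// ler0n.
exists (fun i j => B (i, j)).
apply: filterS (@filter_forall nat (I * I)%type (fun ij n => g n ij.1 ij.2 = B ij) q _ BP).
move=> n gB; apply/funext => i; apply/funext => j; exact: (gB (i, j)).
Qed.

Section Core.
Variables (R : realType) (I : finType) (om : I -> nat) (k : nat).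
Variable q : set_system nat.
Hypotheses (k1 : (1 < k)%N) (Uq : UltraFilter q) (Iq : idempotent q).
Hypothesis qinf : forall m, \forall n \near q, (m <= n)%N.
Variables (W V : nat -> I -> I -> R) (g : nat -> nat -> I -> I -> int).
Hypotheses (shW : forall n, shape om (W n)) (shV : forall n, shape om (V n)).
Hypotheses (WV : forall n, mulf (W n) (V n) = idf R (I := I))
           (VW : forall n, mulf (V n) (W n) = idf R (I := I)).
Hypothesis Wg : forall l n, W (l + n) = mulf (toR R (g l n)) (dil om (k ^ l) (W n)).
Variable C : R.
Hypotheses (WC : forall n i j, `|W n i j| <= C) (VC : forall n i j, `|V n i j| <= C).

Lemma stable_signs (J : finType) (c : J -> I -> int) (nu : J -> I) :
  exists l0 (Wo : I -> I -> R), (forall i j, ulim q (fun n => W (l0 + n) i j) (Wo i j)) /\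
  exists e m0, 0 < e /\ forall m (h : I -> I -> int), (m0 <= m)%N ->
    (forall i j, `|mulf (toR R h) (dil om m Wo) i j - Wo i j| < e) ->
    \forall n \near q, forall j,
      Num.sg (dot (fun i => (c j i)%:~R)
        (fun i => mulf (toR R h) (dil om m (W (l0 + n))) i (nu j))) =
      Num.sg (dot (fun i => (c j i)%:~R) (fun i => W (l0 + n) i (nu j))).
Proof.
have /choice [Wl Wlq] : forall l, exists B, forall i j,
    ulim q (fun n => W (l + n) i j) (B i j).
  by move=> l; apply: (ex_matrix_limit Uq (C := C)) => n; exact: WC.
have [Vo Voq] := ex_matrix_limit Uq VC.
have /choice [gl glq] : forall l, exists gl, \forall n \near q, g l n = gl.
  by move=> l; exact: (ex_g_limit Uq shW shV WV (Wg l) WC VC).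
pose u j i := (c j i)%:~R : R.
have /choice [rs rsP] := fun j => scales (fun n i => W n i (nu j)) Uq.
pose d := (\max_i om i).+1.
have omd i : (om i < d)%N by rewrite ltnS leq_bigmax.
pose x j (a : nat) := app Vo (nth (fun=> 0) (rs j) a).
(* Each coefficient either vanishes for [q]-most [l], and then idempotence keeps it zero at
   [l0 + l], or is nonzero for [q]-most [l0]. There are finitely many, so one [l0] suits all. *)
have [l0 l0P] : exists l0, forall j (a : 'I_(size (rs j))) (w : 'I_d),
    dot (u j) (app (Wl l0) (wpart om w (x j a))) != 0 \/
    \forall l \near q, dot (u j) (app (Wl (l0 + l)%N) (wpart om w (x j a))) = 0.
  apply: (@filter_ex _ q _); apply: filter_forall => j; apply: filter_forall => a.
  apply: filter_forall => w.
  have [/Iq|] := ultraVN (fun l => dot (u j) (app (Wl l) (wpart om w (x j a))) = 0) Uq.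
    by apply: filterS; right.
  by apply: filterS => l /eqP; left.
exists l0, (Wl l0); split; first exact: Wlq.
pose W' n := W (l0 + n)%N; pose V' n := V (l0 + n)%N; pose g' l n := g l (l0 + n)%N.
pose Wl' l := Wl (l0 + l)%N.
have W'g l n : W' (l + n)%N = mulf (toR R (g' l n)) (dil om (k ^ l) (W' n)).
  by rewrite /W' addnCA Wg.
have W'lq l i j : ulim q (fun n => W' (l + n)%N i j) (Wl' l i j).
  by apply: (ulim_ext (Wlq (l0 + l)%N i j)) => // n; rewrite /W' addnA.
have [Vo' Vo'q] : exists B, forall i j, ulim q (fun n => V' n i j) (B i j).
  by apply: (ex_matrix_limit Uq (C := C)) => n; exact: VC.
have /choice [gl' gl'q] : forall l, exists gl', \forall n \near q, g' l n = gl'.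
  move=> l; apply: (ex_g_limit Uq _ _ _ (W'g l) _ _ (V := V') (C := C)) => n.
  - exact: shW.
  - exact: shV.
  - exact: WV.
  - exact: WC.
  - exact: VC.
have W'0 : Wl' 0%N = Wl l0 by rewrite /Wl' addn0.
(* Directions for the shifted sequence: those of [W n] transported by the matrix that leads from
   [W n] to [W (l0 + n)]. *)
pose rs' j := [seq app (toR R (gl l0)) (dilv om (k ^ l0) r) | r <- rs j].
have H j : exists e m0, 0 < e /\ forall m h, (m0 <= m)%N ->
    close om Wl' e m h -> \forall n \near q,
    Num.sg (dot (u j) (fun i => mulf (toR R h) (dil om m (W' n)) i (nu j))) =
    Num.sg (dot (u j) (fun i => W' n i (nu j))).
  apply: (stable_sg k1 Uq Iq qinf _ _ _ W'g W'lq Vo'q gl'q (c := c j) (rs := rs' j)).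
  - by move=> n; exact: shW.
  - by move=> n; exact: shV.
  - by move=> n; exact: WV.
  - move=> v; apply: filterS2 (rsP j (pullback om v (k ^ l0) (gl l0))) (glq l0) => n sn gn.
    rewrite /W' Wg gn (sg_col shW) ?expn_gt0; last by rewrite ltnW.
    rewrite sn /rs' -map_comp; congr lexsg; apply: eq_map => r /=.
    by rewrite dot_row.
  - move=> a; rewrite size_map => ars w.
    have Vr r : app Vo' (app (toR R (gl l0)) (dilv om (k ^ l0) r)) =
        dilv om (k ^ l0) (app Vo r).
      have {1}-> : r = app (Wl 0%N) (app Vo r).
        by rewrite -app_mulf (WVo Uq WV Wlq Voq) app_idf.
      rewrite -(app_Wl Uq shW Wg Wlq glq) -W'0 -app_mulf.
      by rewrite (VWo Uq _ W'lq Vo'q) ?app_idf// => n; exact: VW.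
    rewrite (nth_map (fun=> 0))// Vr comp_dilv W'0 /=.
    rewrite dot_dilv_comp -/(x j a).
    have [wd|dw] := ltnP w d; last first.
      right; apply: nearW => l; rewrite dot_dilv_comp.
      have -> : wpart om w (x j a) = (fun i => 0 * x j a i).
        apply/funext => i; rewrite /wpart; case: eqP => [iw|_]; rewrite mul0r//.
        by have := omd i; rewrite iw ltnNge dw.
      by rewrite appZ dotZ mul0r mulr0.
    have [h0|h0] := l0P j (Ordinal ars) (Ordinal wd).
      left; rewrite mulf_neq0// expf_neq0// pnatr_eq0 expn_eq0; lia.
    by right; apply: filterS h0 => l h; rewrite dot_dilv_comp h mulr0.
have /choice [em emP] : forall j, exists em : R * nat, 0 < em.1 /\
    forall m h, (em.2 <= m)%N -> close om Wl' em.1 m h -> \forall n \near q,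
    Num.sg (dot (u j) (fun i => mulf (toR R h) (dil om m (W' n)) i (nu j))) =
    Num.sg (dot (u j) (fun i => W' n i (nu j))).
  by move=> j; have [e [m0 P]] := H j; exists (e, m0).
have [||e e0 eP] := @unif_eta R J (fun j e => e <= (em j).1).
- by move=> j e e' ee; exact: le_trans.
- by move=> j; exists (em j).1 => //; case: (emP j).
exists e, (\max_j (em j).2); split=> // m h mm cl.
apply: filter_forall => j; have [_ P] := emP j; apply: P.
  by rewrite (leq_trans _ mm)// leq_bigmax.
move=> i i'; rewrite W'0; exact: lt_le_trans (cl i i') (eP j).
Qed.

End Core.

(** * Representation of generalised polynomials *)

Section AdmissibleConstants.
Variables (p : set_system nat).
Hypothesis Up : UltraFilter p.

Definition adm_from (v : int) (f : nat -> int) := adm p (fun a => f a - v).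

Lemma adm_fromM v w f g : adm_from v f -> adm_from w g ->
  adm_from (v * w) (fun a => f a * g a).
Proof.
move=> Af Ag.
have := admD Up (admM Up Af Ag) (admD Up (admZ Up v Ag) (admZ Up w Af)).
by move/adm_ext; apply => a; ring.
Qed.

Lemma adm_from_cst v : adm_from v (fun=> v).
Proof. by apply: adm_ext (adm0 Up) _ => a; rewrite subrr. Qed.

Lemma adm_fromX v f e : adm_from v f -> adm_from (v ^+ e) (fun a => f a ^+ e).
Proof.
move=> Af; elim: e => [|e IH]; first exact: adm_from_cst.
have := adm_fromM Af IH; rewrite -exprS => /adm_ext; apply => a.
by rewrite !exprS.
Qed.

Lemma adm_succ : adm_from 1 (fun a => a.+1%:Z).
Proof. by apply: adm_ext (adm_id Up) _ => a; rewrite -addn1 PoszD addrK. Qed.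

End AdmissibleConstants.

Section Systems.
Variable R : realType.

(* A system packages a torus of dilations [dil m], a group [Gam] of integral
   matrices and a set [Grp] of real ones, stable under [act g m]. The basis vectors
   stand for monomials in integral brackets: [seps] evaluates them at the origin,
   [sone] is the constant monomial, and [value g i] below is the value of the [i]-th
   monomial at [N] as soon as the tests single out [act g N sW0]. The weight [som]
   is the codegree, so that a coefficient of weight [w] scales as [N ^ w]. *)
Record system := System {
  sI : finType;
  som : sI -> nat;
  seps : sI -> int;
  sone : sI;
  sGam : (sI -> sI -> int) -> Prop;
  sGrp : (sI -> sI -> R) -> Prop;
  sW0 : sI -> sI -> R;
  sJ : finType;
  stst : sJ -> (sI -> int) * sI * bool }.

Definition test_pos (strict : bool) (t : R) := if strict then 0 < t else 0 <= t.

Definition intv (I : Type) (c : I -> int) : I -> R := fun i => (c i)%:~R.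

Definition pass (S : system) (W : sI S -> sI S -> R) := forall j : sJ S,
  let t := stst j in test_pos t.2 (dot (intv t.1.1) (W^~ t.1.2)).

Definition strict_shape (I : finType) (om : I -> nat) (g : I -> I -> int) :=
  forall i, g i i = 1 /\ forall j, i != j -> (om i <= om j)%N -> g i j = 0.

Definition invertible (I : finType) (om : I -> nat) (C : R) (W : I -> I -> R) :=
  (forall i j, `|W i j| <= C) /\
  exists V, [/\ shape om V, mulf W V = @idf R I, mulf V W = @idf R I &
    forall i j, `|V i j| <= C].

Definition act (S : system) (g : sI S -> sI S -> int) m (W : sI S -> sI S -> R) :=
  mulf (toR R g) (dil (@som S) m W).

(** [wf_red] and [wf_inv] say that the tests cut out a bounded domain that [Gam] reaches from every
    [dil m sW0]. The admissible entries in [wf_rec] allow the recurrence to pass to an extension,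
    where their products with reals are rounded. *)
Record wf (S : system) : Prop := Wf {
  wf_strict : forall g, @sGam S g -> strict_shape (@som S) g;
  wf_unit : forall g, @sGam S g -> forall i, g i (sone S) = (i == sone S)%:R;
  wf_eps : seps (sone S) = 1;
  wf_unitR : forall W, @sGrp S W -> forall i, W i (sone S) = (i == sone S)%:R;
  wf_W0 : sGrp (@sW0 S);
  wf_shape : forall W, @sGrp S W -> shape (@som S) W;
  wf_inv : exists C, forall W, sGrp W -> @pass S W -> invertible (@som S) C W;
  wf_act : forall g m W, sGam g -> @sGrp S W -> sGrp (act g m W);
  wf_mul : forall g m g', @sGam S g -> sGam g' -> sGam (mulf g (dil (@som S) m g'));
  wf_div : forall g m g', @sGam S g -> sGam g' ->
    exists2 g'', sGam g'' & g = mulf g'' (dil (@som S) m g');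
  wf_closed : forall q (W : nat -> sI S -> sI S -> R) Wo, UltraFilter q ->
    (forall n, sGrp (W n)) -> (forall i j, ulim q (fun n => W n i j) (Wo i j)) ->
    sGrp Wo;
  wf_rec : forall p W, UltraFilter p -> idempotent p -> sGrp W ->
    exists g : nat -> sI S -> sI S -> int, [/\ forall a, sGam (g a),
      forall i j, adm_from p (i == j)%:R (fun a => g a i j) &
      forall i j, ulim p (fun a => act (g a) a.+1 W i j) (W i j)];
  wf_red : forall m, exists2 g, @sGam S g & pass (act g m (@sW0 S)) }.

Definition value (S : system) (g : sI S -> sI S -> int) (i : sI S) : int :=
  \sum_l seps l * g l i.

(** The formula is required of every reducing [g]: at [(1 + a) k ^ n] the matrix comes from
    recurrence and cannot be chosen. *)
Definition rep (S : system) (f : nat -> R) := exists a : sI S -> {poly R},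
  forall N g, (0 < N)%N -> sGam g -> pass (act g N (@sW0 S)) ->
  f N = \sum_i (a i).[N%:R] * (value g i)%:~R.

Lemma strict_shapeW (I : finType) (om : I -> nat) g : strict_shape om g -> shape om g.
Proof.
move=> sg i j ij; apply: (sg i).2; last exact: ltnW.
by apply: contraTneq ij => ->; rewrite ltnn.
Qed.

Lemma val_one (S : system) g : wf S -> sGam g -> value g (sone S) = 1.
Proof.
move=> wS Gg; rewrite /value (bigD1 (sone S))//= big1 => [|i /negPf i1].
  by rewrite (wf_unit wS)// eqxx (wf_eps wS) mulr1 addr0.
by rewrite (wf_unit wS)// i1 mulr0.
Qed.

Lemma rep_cst (S : system) c : wf S -> rep S (fun=> c).
Proof.
move=> wS; exists (fun i => if i == sone S then c%:P else 0) => N g N0 Gg _.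
rewrite (bigD1 (sone S))//= eqxx val_one// hornerC mulr1 big1 ?addr0// => i /negPf ->.
by rewrite horner0 mul0r.
Qed.

Lemma rep_id (S : system) : wf S -> rep S (fun N => N%:R).
Proof.
move=> wS; exists (fun i => if i == sone S then 'X else 0) => N g N0 Gg _.
rewrite (bigD1 (sone S))//= eqxx val_one// hornerX mulr1 big1 ?addr0// => i /negPf ->.
by rewrite horner0 mul0r.
Qed.

Lemma repD (S : system) f h : rep S f -> rep S h -> rep S (fun N => f N + h N).
Proof.
move=> [a fa] [b hb]; exists (fun i => a i + b i) => N g N0 Gg Pg.
rewrite (fa N g)// (hb N g)// -big_split; apply: eq_bigr => i _ /=.
by rewrite hornerD mulrDl.
Qed.

Definition base_system : system := @System unit (fun=> 0%N) (fun=> 1) tt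
  (fun g => g = idf _ (I := _)) (fun W => W = idf _ (I := _)) (idf _ (I := _))
  'I_0 (fun=> (fun=> 0, tt, false)).

Lemma toR_act1 m :
  mulf (toR R (@idf int unit)) (dil (fun=> 0%N) m (@idf R unit)) = @idf R unit.
Proof. by rewrite toR_idf dil_idf mulf1. Qed.

Lemma wf_base : wf base_system.
Proof.
split=> //=.
- by move=> g -> i; split; [rewrite /idf eqxx|case: i => -[]; rewrite eqxx].
- by move=> g ->.
- by move=> W ->.
- exists 1 => W -> _; have le1 (i j : unit) : `|idf R i j| <= 1.
    by rewrite /idf; case: eqP => _; rewrite ?normr1 ?normr0.
  split=> //; exists (idf _ (I := _)); split=> //; rewrite ?mulf1//.
- by move=> g m W -> ->; rewrite /act toR_act1.
- by move=> g m g' -> ->; rewrite dil_idf mulf1.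
- by move=> g m g' -> ->; exists (idf _ (I := _)); rewrite // dil_idf mulf1.
- move=> q W Wo Uq WE Wq; apply/funext => i; apply/funext => j.
  apply: (ulim_unique _ (Wq i j)); apply: (ulim_ext (ulim_cst (idf R i j) _)) => // n.
  by rewrite WE.
- move=> p W Up Ip ->; exists (fun=> idf _ (I := _)); split=> // i j.
    exact: adm_from_cst.
  by apply: (ulim_ext (ulim_cst (idf R i j) _)) => // n; rewrite /act toR_act1.
- by move=> m; exists (idf _ (I := _)) => // -[].
Qed.

End Systems.

(** * Products: tensor squares of systems *)

Lemma sum3 (K : comNzRingType) (I1 I2 I3 : finType) (F : I1 -> I2 -> I3 -> K) :
  \sum_(p : I1 * I2 * I3) F p.1.1 p.1.2 p.2 = \sum_a \sum_b \sum_c F a b c.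
Proof.
rewrite -(pair_bigA _ (fun p c => F p.1 p.2 c)) /=.
by rewrite -(pair_bigA _ (fun a b => \sum_c F a b c)).
Qed.

Section Tensor.
Variables (I : finType) (om : I -> nat) (k : nat).

Definition omT (x : I * I * 'I_k) : nat := (om x.1.1 + om x.1.2 + x.2)%N.

Definition tens (K : comNzRingType) (A : I -> I -> K) :
    I * I * 'I_k -> I * I * 'I_k -> K :=
  fun x y => A x.1.1 y.1.1 * A x.1.2 y.1.2 * (x.2 == y.2)%:R.

Lemma tens_mulf (K : comNzRingType) (A B : I -> I -> K) :
  tens (mulf A B) = mulf (tens A) (tens B).
Proof.
apply/funext => x; apply/funext => y; rewrite /mulf /tens.
rewrite (sum3 (fun a b c => A x.1.1 a * A x.1.2 b * (x.2 == c)%:R *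
  (B a y.1.1 * B b y.1.2 * (c == y.2)%:R))).
rewrite big_distrlr mulr_suml; apply: eq_bigr => a _.
rewrite mulr_suml; apply: eq_bigr => b _.
rewrite (bigD1 x.2)//= eqxx big1 ?addr0 => [|c /negPf]; last first.
  by rewrite eq_sym => ->; rewrite mulr0 mul0r.
by rewrite mulr1; set e := _%:R; ring.
Qed.

Lemma dil_tens (K : comNzRingType) m (A : I -> I -> K) : shape om A ->
  dil omT m (tens A) = tens (dil om m A).
Proof.
move=> sA; apply/funext => x; apply/funext => y; rewrite /dil /tens /omT.
case: (ltnP (om x.1.1) (om y.1.1)) => h1; first by rewrite sA// !(mul0r, mulr0).
case: (ltnP (om x.1.2) (om y.1.2)) => h2; first by rewrite (sA x.1.2)// !(mul0r, mulr0).
case: eqP => [->|_]; last by rewrite !mulr0.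
rewrite !mulr1 mulrACA -exprD; congr (_ ^+ _ * _).
rewrite subnDr; move: (om x.1.1) (om x.1.2) (om y.1.1) (om y.1.2) h1 h2 => *; lia.
Qed.

Lemma tens_idf (K : comNzRingType) : tens (@idf K I) = @idf K (I * I * 'I_k)%type.
Proof.
apply/funext => -[[a b] c]; apply/funext => -[[a' b'] c'].
by rewrite /tens /idf -!natrM !mulnb.
Qed.

Lemma toR_tens (R : realType) (g : I -> I -> int) : toR R (tens g) = tens (toR R g).
Proof.
apply/funext => x; apply/funext => y; rewrite /toR /tens !rmorphM /=.
by case: eqP.
Qed.

Lemma shape_tens (K : comNzRingType) (A : I -> I -> K) : shape om A -> shape omT (tens A).
Proof.
move=> sA x y; rewrite /omT /tens => xy.
case: (ltnP (om x.1.1) (om y.1.1)) => h1; first by rewrite sA// !(mul0r, mulr0).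
case: (ltnP (om x.1.2) (om y.1.2)) => h2; first by rewrite (sA x.1.2)// !(mul0r, mulr0).
case: eqP => [xy2|_]; rewrite ?mulr0//.
by move: xy; rewrite xy2 ltn_add2r ltnNge leq_add.
Qed.

Lemma strict_tens (g : I -> I -> int) : strict_shape om g -> strict_shape omT (tens g).
Proof.
move=> sg x; split; first by rewrite /tens !(sg _).1 eqxx.
move=> y xy; rewrite /omT /tens => lexy.
have sg' := strict_shapeW sg.
case: (ltnP (om x.1.1) (om y.1.1)) => h1; first by rewrite sg'// !mul0r.
case: (ltnP (om x.1.2) (om y.1.2)) => h2; first by rewrite (sg' x.1.2)// mulr0 mul0r.
case: eqP => [xy2|_]; last by rewrite mulr0.
move: lexy; rewrite xy2 leq_add2r => lexy.
have le1 : (om x.1.1 <= om y.1.1)%N.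
  by move: (om x.1.1) (om x.1.2) (om y.1.1) (om y.1.2) lexy h1 h2 => *; lia.
have le2 : (om x.1.2 <= om y.1.2)%N.
  by move: (om x.1.1) (om x.1.2) (om y.1.1) (om y.1.2) lexy h1 h2 => *; lia.
have [e1|n1] := eqVneq x.1.1 y.1.1; last by rewrite (sg _).2// !mul0r.
have [e2|n2] := eqVneq x.1.2 y.1.2; last by rewrite (sg x.1.2).2// mulr0 mul0r.
case/eqP: xy.
case: x y e1 e2 xy2 {lexy h1 h2 le1 le2} => [[a b] c] [[a' b'] c'] /= -> -> xy2.
by rewrite xy2.
Qed.

End Tensor.

Section TensorSystem.
Variables (R : realType) (S : system R) (k : nat).

Let I := (sI S * sI S * 'I_k.+1)%type.
Let one : I := (sone S, sone S, ord0).

Definition row_tens (c : sI S -> int) : I -> int :=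
  fun x => if (x.1.2 == sone S) && (x.2 == ord0) then c x.1.1 else 0.

(* The column tensors of a system realise the products of its brackets; the third
   factor, on which [Gam] acts trivially, provides copies with shifted weights. *)
Definition tens_system : system R := @System R I (@omT (sI S) (@som R S) k.+1)
  (fun x => seps x.1.1 * seps x.1.2) one
  (fun G => exists2 g, sGam g & G = @tens (sI S) k.+1 int g)
  (fun Z => exists2 W, sGrp W & Z = @tens (sI S) k.+1 R W)
  (@tens (sI S) k.+1 R (@sW0 R S)) (sJ S)
  (fun j => let t := stst j in (row_tens t.1.1, (t.1.2, sone S, ord0), t.2)).

Hypothesis wS : wf S.

Lemma dot_row_tens c nu W : sGrp W ->
  dot (intv R (row_tens c)) (fun x => tens W x (nu, sone S, ord0)) =
  dot (intv R c) (W^~ nu).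
Proof.
move=> GW; rewrite /dot /intv /row_tens /tens /=.
rewrite (sum3 (fun a b d => (if (b == sone S) && (d == ord0) then c a else 0)%:~R *
  (W a nu * W b (sone S) * (d == ord0 :> 'I_k.+1)%:R))).
apply: eq_bigr => a _; rewrite (bigD1 (sone S))//= eqxx [X in _ + X]big1 => [|b /negPf b1].
  rewrite addr0 (bigD1 ord0)//= big1 => [|d /negPf d0]; last by rewrite d0 mul0r.
  by rewrite (wf_unitR wS)// !eqxx !mulr1 addr0.
by rewrite big1// => d _; rewrite b1 mul0r.
Qed.

Lemma pass_tens W : sGrp W -> (@pass R tens_system (tens W) <-> pass W).
Proof.
move=> GW; split=> P j; have := P j; rewrite /= /test_pos dot_row_tens//.
Qed.

Lemma act_tens g m W : sGam g -> sGrp W ->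
  @act R tens_system (tens g) m (tens W) = tens (act g m W).
Proof.
move=> Gg GW; rewrite /act /= toR_tens dil_tens; last exact: wf_shape.
by rewrite tens_mulf.
Qed.

Definition untens (Z : I -> I -> R) : sI S -> sI S -> R :=
  fun i j => Z (i, sone S, ord0) (j, sone S, ord0).

Lemma tensK W : sGrp W -> untens (tens W) = W.
Proof.
move=> GW; apply/funext => i; apply/funext => j.
by rewrite /untens /tens /= (wf_unitR wS)// !eqxx !mulr1.
Qed.

Lemma val_tens g x : sGam g ->
  @value R tens_system (tens g) x = value g x.1.1 * value g x.1.2.
Proof.
move=> Gg; rewrite /value /tens /=.
rewrite (sum3 (fun a b d => seps a * seps b *
  (g a x.1.1 * g b x.1.2 * (d == x.2)%:R))) big_distrlr; apply: eq_bigr => a _.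
apply: eq_bigr => b _; rewrite (bigD1 x.2)//= eqxx mulr1.
rewrite big1 => [|d /negPf ->]; last by rewrite !mulr0.
by rewrite addr0; ring.
Qed.

Lemma wf_tens : wf tens_system.
Proof.
split=> /=.
- by move=> _ [g Gg ->]; apply: strict_tens; exact: wf_strict.
- move=> _ [g Gg ->] x; rewrite /tens /= !(wf_unit wS)//.
  by case: x => [[a b] c]; rewrite -!natrM !mulnb.
- by rewrite (wf_eps wS) mulr1.
- move=> _ [W GW ->] x; rewrite /tens /= !(wf_unitR wS)//.
  by case: x => [[a b] c]; rewrite -!natrM !mulnb.
- by exists (@sW0 R S) => //; exact: wf_W0.
- by move=> _ [W GW ->]; apply: shape_tens; exact: wf_shape.
- have [C CP] := wf_inv wS; exists (C * C) => _ [W GW ->] /(pass_tens GW) /(CP _ GW).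
  move=> [WC [V [sV WV VW VC]]].
  have bnd A : (forall i j, `|A i j| <= C) ->
      forall x y, `|@tens (sI S) k.+1 R A x y| <= C * C.
    move=> AC x y; rewrite /tens !normrM normr_nat.
    rewrite (le_trans (_ : _ <= `|A x.1.1 y.1.1| * `|A x.1.2 y.1.2| * 1))//.
      by rewrite ler_wpM2l ?mulr_ge0// lern1 leq_b1.
    by rewrite mulr1 ler_pM.
  split; first exact: bnd.
  exists (tens V); split; [exact: shape_tens| | |exact: bnd].
  + by rewrite -tens_mulf WV tens_idf.
  + by rewrite -tens_mulf VW tens_idf.
- move=> _ m _ [g Gg ->] [W GW ->]; rewrite act_tens//.
  by exists (act g m W) => //; exact: wf_act.
- move=> _ m _ [g Gg ->] [g' Gg' ->]; exists (mulf g (dil (@som R S) m g')).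
    exact: wf_mul.
  rewrite dil_tens ?tens_mulf//; apply: strict_shapeW; exact: wf_strict.
- move=> _ m _ [g Gg ->] [g' Gg' ->]; have [g'' Gg'' ->] := wf_div wS m Gg Gg'.
  exists (tens g''); first by exists g''.
  rewrite dil_tens ?tens_mulf//; apply: strict_shapeW; exact: wf_strict.
- move=> q W Wo Uq GW Wq.
  have GU n : sGrp (untens (W n)) by have [w Gw ->] := GW n; rewrite tensK.
  have qU i j : ulim q (fun n => untens (W n) i j) (untens Wo i j) by exact: Wq.
  exists (untens Wo); first exact: (wf_closed wS Uq GU).
  apply/funext => x; apply/funext => y; apply: (ulim_unique _ (Wq x y)).
  have T : ulim q (fun n => tens (untens (W n)) x y) (tens (untens Wo) x y).
    by apply: ulimM; [apply: ulimM; exact: qU|exact: ulim_cst].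
  apply: (ulim_ext T) => // n; have [w Gw ->] := GW n; by rewrite tensK.
- move=> p _ Up Ip [W GW ->]; have [g [Gg Ag lg]] := wf_rec wS Up Ip GW.
  exists (fun a => tens (g a)); split.
  + by move=> a; exists (g a).
  + move=> x y; have -> : (x == y)%:R =
        (x.1.1 == y.1.1)%:R * (x.1.2 == y.1.2)%:R * (x.2 == y.2)%:R :> int.
      by case: x y => [[a b] c] [[a' b'] c'] /=; rewrite -!natrM !mulnb.
    by apply: adm_fromM => //; [apply: adm_fromM|exact: adm_from_cst].
  + move=> x y; have T : ulim p (fun a => tens (act (g a) a.+1 W) x y) (tens W x y).
      by apply: ulimM; [apply: ulimM; exact: lg|exact: ulim_cst].
    by apply: (ulim_ext T) => // a; rewrite act_tens.
- move=> m; have [g Gg Pg] := wf_red wS m; exists (tens g); first by exists g.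
  rewrite act_tens//; last exact: wf_W0.
  by apply/pass_tens => //; apply: wf_act => //; exact: wf_W0.
Qed.

Lemma rep_tensM f h : rep S f -> rep S h -> rep tens_system (fun N => f N * h N).
Proof.
move=> [a fa] [b hb].
exists (fun x : I => if x.2 == ord0 then a x.1.1 * b x.1.2 else 0).
move=> N _ N0 [g Gg ->] Pg.
have {}Pg : pass (act g N (@sW0 R S)).
  apply/pass_tens; first by apply: wf_act => //; exact: wf_W0.
  by rewrite -act_tens//; exact: wf_W0.
rewrite (fa N g)// (hb N g)//=.
under [RHS]eq_bigr do rewrite val_tens//.
rewrite (sum3 (fun c d e => (if e == ord0 :> 'I_k.+1 then a c * b d else 0).[N%:R] *
  (value g c * value g d)%:~R)) big_distrlr; apply: eq_bigr => c _; apply: eq_bigr => d _.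
rewrite (bigD1 ord0)//= big1 ?addr0 => [|e /negPf ->]; last by rewrite horner0 mul0r.
by rewrite hornerM rmorphM /=; ring.
Qed.

Lemma rep_tens f : rep S f -> rep tens_system f.
Proof.
move=> Sf; have [a aP] := rep_tensM Sf (rep_cst 1 wS); exists a => N g N0 Gg Pg.
by rewrite -(aP N g)// mulr1.
Qed.

End TensorSystem.

(** * Integer parts: systems extended by one column *)

Lemma big_option (K : nmodType) (I : finType) (F : option I -> K) :
  \sum_p F p = F None + \sum_i F (Some i).
Proof.
rewrite (bigD1 None)//=; congr (_ + _).
rewrite (reindex_omap Some id) => [|[i|]]//=.
by apply: eq_bigl => i; rewrite eqxx.
Qed.

Section Bordered.
Variables (K : comNzRingType) (I : finType).
Implicit Types (A B : I -> I -> K) (x y : I -> K).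

Definition bord A x : option I -> option I -> K := fun p r =>
  match p, r with
  | Some i, Some j => A i j
  | Some i, None => x i
  | None, Some _ => 0
  | None, None => 1
  end.

Lemma bord_mulf A x B y :
  mulf (bord A x) (bord B y) = bord (mulf A B) (fun i => app A y i + x i).
Proof.
apply/funext => p; apply/funext => r; rewrite /mulf big_option.
case: p r => [i|] [j|] /=.
- by rewrite mulr0 add0r.
- by rewrite mulr1 addrC.
- by rewrite mulr0 big1 ?addr0// => a _; rewrite mul0r.
- by rewrite mulr1 big1 ?addr0// => a _; rewrite mul0r.
Qed.

Lemma bord_idf : @idf K (option I) = bord (@idf K I) (fun=> 0).
Proof. by apply/funext => -[i|]; apply/funext => -[j|]. Qed.

Definition bomega (om : I -> nat) n : option I -> nat :=
  fun p => if p is Some i then om i else n.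

Lemma dil_bord om n m A x :
  dil (bomega om n) m (bord A x) = bord (dil om m A) (fun i => m%:R ^+ (om i - n) * x i).
Proof.
apply/funext => -[i|]; apply/funext => -[j|] //; rewrite /dil /=.
  by rewrite mulr0.
by rewrite subnn mul1r.
Qed.

Lemma dot_bord (u : option I -> K) A x r : dot u (fun p => bord A x p r) =
  if r is Some j then dot (fun i => u (Some i)) (A^~ j)
  else u None + dot (fun i => u (Some i)) x.
Proof.
rewrite /dot big_option; case: r => [j|] /=; first by rewrite mulr0 add0r.
by rewrite mulr1.
Qed.

Lemma shape_bord om n A x : shape om A -> (forall i, (om i < n)%N -> x i = 0) ->
  shape (bomega om n) (bord A x).
Proof.
by move=> sA x0 [i|] [j|] //=; [exact: sA|exact: x0|rewrite ltnn].
Qed.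

End Bordered.

Lemma toR_bord (R : realType) (I : finType) (g : I -> I -> int) c :
  toR R (bord g c) = bord (toR R g) (intv R c).
Proof. by apply/funext => -[i|]; apply/funext => -[j|]. Qed.

Section ExtensionSystem.
Variables (R : realType) (S : system R) (n : nat) (P : sI S -> R) (top : sI S).
Notation om := (@som R S).
Notation I := (sI S).

(** Together with [ext_row1] this encodes [0 <= t < 1], the constant 1 being read off the corner of
    [bord]. An index that needs no test gets the zero form, which passes trivially. *)
Definition ext_row (o : option I) : option I -> int := fun p =>
  match o, p with
  | Some i, Some i' => ((i' == i) && (n < om i)%N && (i != top))%:R
  | None, Some i' => seps i'
  | _, None => 0
  end.

Definition ext_row1 (o p : option I) : int := (p == None)%:R - ext_row o p.

Definition lift_row (c : I -> int) : option I -> int :=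
  fun p => if p is Some i then c i else 0.

(* The column [None] carries the real coefficients of a bracket. The integral part of
   each coefficient of positive relative weight is removed by a test, except at [top],
   where the test bears on the value at the origin: this value is then the fractional
   part of the bracket, and [- value None] its integral part. *)
Definition ext_system : system R := @System R (option I) (bomega om n)
  (lift_row (@seps R S)) (Some (sone S))
  (fun G => exists g c, [/\ sGam g, forall i, (om i <= n)%N -> c i = 0 & G = bord g c])
  (fun Z => exists W x, [/\ sGrp W, forall i, (om i <= n)%N -> x i = P i & Z = bord W x])
  (bord (@sW0 R S) P) (sJ S + option I * bool)%type
  (fun j => match j with
    | inl j => let t := stst j in (lift_row t.1.1, Some t.1.2, t.2)
    | inr (o, b) =>
        (if b then ext_row1 o else ext_row o, None, b)
    end).

Hypotheses (wS : wf S) (P0 : forall i, (om i < n)%N -> P i = 0).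
Hypotheses (topn : (n < om top)%N) (epstop : seps top = 1).

Lemma pass_ext W x : @pass R ext_system (bord W x) <->
  [/\ pass W, forall i, (n < om i)%N -> i != top -> 0 <= x i < 1 &
    0 <= dot (intv R (@seps R S)) x < 1].
Proof.
have E o : dot (intv R (ext_row o)) (fun p => bord W x p None) =
    if o is Some i then if (n < om i)%N && (i != top) then x i else 0
    else dot (intv R (@seps R S)) x.
  rewrite dot_bord /intv; case: o => [i|] /=; rewrite mulr0z add0r//.
  rewrite /dot (bigD1 i)//= big1 => [|j /negPf ->]; last by rewrite mul0r.
  by rewrite eqxx addr0 /=; case: ifP; rewrite ?mul1r ?mul0r.
have E1 o : dot (intv R (ext_row1 o)) (fun p => bord W x p None) =
    1 - dot (intv R (ext_row o)) (fun p => bord W x p None).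
  rewrite !dot_bord /intv /ext_row1; have -> : ext_row o None = 0 by case: o.
  rewrite mulr0z add0r /dot -sumrN; congr (_ + _); apply: eq_bigr => j _.
  by rewrite /= sub0r rmorphN mulNr.
split=> [PP|[PW Px Pt]].
- split.
  + by move=> j; have := PP (inl j); rewrite /= dot_bord.
  + move=> i ni it; have := PP (inr (Some i, false)); have := PP (inr (Some i, true)).
    by rewrite /= E1 !E ni it /= subr_gt0 => -> ->.
  + have := PP (inr (None, false)); have := PP (inr (None, true)).
    by rewrite /= E1 !E /= subr_gt0 => -> ->.
- move=> [j|[o b]]; first by have := PW j; rewrite /= dot_bord.
  have H : 0 <= dot (intv R (ext_row o)) (fun p => bord W x p None) < 1.
    rewrite E; case: o => [i|//]; case: ifP => [/andP[ni it]|_]; first exact: Px.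
    by rewrite lexx ltr01.
  by case: b => /=; rewrite ?E1 ?subr_gt0; case/andP: H.
Qed.

Lemma act_ext g c m W x : @act R ext_system (bord g c) m (bord W x) =
  bord (act g m W)
    (fun i => app (toR R g) (fun j => m%:R ^+ (om j - n) * x j) i + (c i)%:~R).
Proof. by rewrite /act /= toR_bord dil_bord bord_mulf. Qed.

(** Off the diagonal, [g] only brings in entries of weight below [om i <= n], and these are 0. *)
Lemma fixed_column g m (x : I -> R) i : sGam g -> (om i <= n)%N ->
  (forall j, (om j <= n)%N -> x j = P j) ->
  app (toR R g) (fun j => m%:R ^+ (om j - n) * x j) i = P i.
Proof.
move=> Gg iN xP; have sg := wf_strict wS Gg.
rewrite /app (bigD1 i)//= /toR (sg i).1 big1 => [|j ji].
  by rewrite addr0 mul1r (eqP iN) mul1r xP.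
case: (leqP (om i) (om j)) => ij; first by rewrite (sg i).2 ?mul0r// eq_sym.
by rewrite xP ?P0 ?mulr0// ?(leq_trans _ iN)// ltnW// (leq_trans ij).
Qed.

Lemma fixed_zero g m (c : I -> int) i : sGam g -> (om i <= n)%N ->
  (forall j, (om j <= n)%N -> c j = 0) ->
  app g (fun j => m%:R ^+ (om j - n) * c j) i = 0.
Proof.
move=> Gg iN c0; rewrite /app big1// => j _.
case: (leqP (om j) n) => jn; first by rewrite c0// !mulr0.
rewrite (strict_shapeW (wf_strict wS Gg)) ?mul0r//.
exact: leq_ltn_trans iN jn.
Qed.

Let ublock (Z : option I -> option I -> R) : I -> I -> R := fun i j => Z (Some i) (Some j).
Let column (Z : option I -> option I -> R) : I -> R := fun i => Z (Some i) None.

(** The entry at [top] has no test of its own; it is recovered from the value at the origin, where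
    its coefficient is 1. *)
Lemma ext_bounded : exists B, forall x : I -> R,
  (forall i, (om i <= n)%N -> x i = P i) ->
  (forall i, (n < om i)%N -> i != top -> 0 <= x i < 1) ->
  0 <= dot (intv R (@seps R S)) x < 1 -> forall i, `|x i| <= B.
Proof.
pose e (i : I) := `|(seps i)%:~R| : R.
have S0 : 0 <= \sum_i e i * (1 + `|P i|).
  by apply: sumr_ge0 => j _; apply: mulr_ge0; [exact: normr_ge0|exact: addr_ge0].
have P0' : 0 <= \sum_i `|P i| by apply: sumr_ge0.
exists (1 + \sum_i e i * (1 + `|P i|) + \sum_i `|P i|) => x xP xn xt i.
have small j : j != top -> `|x j| <= 1 + `|P j|.
  move=> jt; case: (leqP (om j) n) => jn; first by rewrite xP// lerDr.
  have /andP[x0 x1] := xn j jn jt.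
  by rewrite ger0_norm// (le_trans (ltW x1))// lerDl.
have [->|it] := eqVneq i top; last first.
  rewrite (le_trans (small i it))// -addrA lerD2l.
  by rewrite (le_trans _ (lerD S0 (lexx _)))// add0r (bigD1 i)//= lerDl sumr_ge0.
have E : x top = dot (intv R (@seps R S)) x - \sum_(j | j != top) (seps j)%:~R * x j.
  by rewrite /dot (bigD1 top)//= /intv epstop mul1r addrK.
rewrite E (le_trans (ler_normB _ _))// -addrA lerD//.
  by case/andP: xt => t0 t1; rewrite ger0_norm// ltW.
rewrite (le_trans (ler_norm_sum _ _ _))// -[leLHS]addr0 lerD//.
rewrite [leRHS](bigD1 top)//= -[leLHS]add0r lerD//.
  by apply: mulr_ge0; [exact: normr_ge0|exact: addr_ge0].
by apply: ler_sum => j jt; rewrite normrM ler_wpM2l// small.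
Qed.

Lemma wf_ext_inv : exists C, forall Z, @sGrp R ext_system Z ->
  @pass R ext_system Z -> invertible (bomega om n) C Z.
Proof.
have [B BP] := ext_bounded; have [C CP] := wf_inv wS.
exists (1 + `|C| + `|B| + \sum_(j : I) `|C| * `|B|) => _ [W [x [GW xP ->]]].
move=> /pass_ext[/(CP _ GW) [WC [V [sV WV VW VC]]] x1 xt].
have xB := BP x xP x1 xt.
have x0 i : (om i < n)%N -> x i = 0 by move=> iN; rewrite xP ?P0// ltnW.
have ge0 : 0 <= \sum_(j : I) `|C| * `|B| by apply: sumr_ge0 => j _; rewrite mulr_ge0.
have C0 := normr_ge0 C; have B0 := normr_ge0 B.
have CC := ler_norm C; have BB := ler_norm B.
split.
  move=> [i|] [j|] /=; rewrite ?normr0 ?normr1; last by lra.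
    by have := WC i j; lra.
    by have := xB i; lra.
  by lra.
exists (bord V (fun i => - app V x i)); split.
- apply: shape_bord => // i iN; rewrite (app_supp sV (w := n))// oppr0//.
- rewrite bord_mulf WV bord_idf; congr bord; apply/funext => i.
  have -> : (fun i => - app V x i) = (fun i => -1 * app V x i).
    by apply/funext => j; rewrite mulN1r.
  by rewrite appZ -app_mulf WV app_idf mulN1r addNr.
- rewrite bord_mulf VW bord_idf; congr bord; apply/funext => i.
  by rewrite subrr.
- have Vx i : `|app V x i| <= \sum_(j : I) `|C| * `|B|.
    rewrite (le_trans (ler_norm_sum _ _ _))//; apply: ler_sum => j _.
    by rewrite normrM ler_pM//; [exact: le_trans (VC i j) CC|exact: le_trans (xB j) BB].
  move=> [i|] [j|] /=; rewrite ?normrN ?normr0 ?normr1; last by lra.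
  + by have := VC i j; lra.
  + by have := Vx i; lra.
  + by lra.
Qed.

Lemma wf_ext_rec p Z : UltraFilter p -> idempotent p -> @sGrp R ext_system Z ->
  exists g : nat -> option I -> option I -> int, [/\ forall a, @sGam R ext_system (g a),
    forall i j, adm_from p (i == j)%:R (fun a => g a i j) &
    forall i j, ulim p (fun a => @act R ext_system (g a) a.+1 Z i j) (Z i j)].
Proof.
move=> Up Ip [W [x [GW xP ->]]]; have [g [Gg Ag lg]] := wf_rec wS Up Ip GW.
have x0 i : (om i < n)%N -> x i = 0 by move=> iN; rewrite xP ?P0// ltnW.
(* The action moves the entry [i] of the column by the sum of the [f i j a * x j]. As [f i j] is
   admissible, removing the nearest integer to each term leaves an error that tends to 0, and these
   integers are again admissible. *)
pose f i j a : int := g a i j * a.+1%:Z ^+ (om j - n) - (i == j)%:R.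
have fadm i j : adm p (f i j).
  have := adm_fromM Up (Ag i j) (adm_fromX Up (om j - n)%N (adm_succ Up)).
  by rewrite expr1n mulr1.
pose c a i : int := if (om i <= n)%N then 0 else - \sum_j rnd ((f i j a)%:~R * x j).
exists (fun a => bord (g a) (c a)); split.
- by move=> a; exists (g a), (c a); split=> // i iN; rewrite /c iN.
- move=> [i|] [j|] /=; last exact: (adm_from_cst Up 1); last exact: (adm_from_cst Up 0).
    exact: (Ag i j).
  rewrite /c /adm_from; case: (leqP (om i) n) => _; first exact: (adm_from_cst Up 0).
  have A := adm_sum Up (P := predT) (fun j _ => adm_rnd Up Ip (x j) (fadm i j)).
  have /adm_ext := admZ Up (-1) A; apply => a; by rewrite mulN1r subr0.
- move=> i j.
  have {}actE a : @act R ext_system (bord (g a) (c a)) a.+1 (bord W x) =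
    bord (act (g a) a.+1 W) (fun i => app (toR R (g a))
      (fun j => a.+1%:R ^+ (om j - n) * x j) i + (c a i)%:~R) by exact: act_ext.
  case: i j => [i|] [j|] /=.
  + by apply: (ulim_ext (lg i j)) => // a; rewrite actE.
  + have [iN|ni] := leqP (om i) n.
      apply: (ulim_ext (ulim_cst (P i) _)) => //; last by rewrite xP.
      by move=> a; rewrite actE /= (fixed_column _ (Gg a))// /c iN addr0.
    have lim0 : ulim p (fun a => x i + \sum_j ((f i j a)%:~R * x j -
        (rnd ((f i j a)%:~R * x j))%:~R)) (x i + \sum_(j : I) 0).
      apply: ulimD; first exact: ulim_cst.
      by apply: ulim_sum => j; exact: (adm_small Up Ip (fadm i j)).
    apply: (ulim_ext lim0); last by rewrite big1 ?addr0.
    move=> a; rewrite actE /= /c leqNgt ni /= rmorphN rmorph_sum /= sumrB addrA.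
    congr (_ - _); rewrite {1}(_ : x i = \sum_j (i == j)%:R * x j); last first.
      rewrite (bigD1 i)//= eqxx mul1r big1 ?addr0// => j.
      by rewrite eq_sym => /negPf ->; rewrite mul0r.
    rewrite /app -big_split; apply: eq_bigr => j _ /=.
    rewrite /f rmorphB rmorphM rmorphXn /= /toR.
    have -> : ((i == j)%:R : int)%:~R = (i == j)%:R :> R by case: eqP.
    by rewrite -mulrDl; ring.
  + by apply: (ulim_ext (ulim_cst 0 _)) => // a; rewrite actE.
  + by apply: (ulim_ext (ulim_cst 1 _)) => // a; rewrite actE.
Qed.

Lemma wf_ext_red m : exists2 g, @sGam R ext_system g &
  @pass R ext_system (@act R ext_system g m (bord (@sW0 R S) P)).
Proof.
have [g Gg Pg] := wf_red wS m.
pose y i := app (toR R g) (fun j => m%:R ^+ (om j - n) * P j) i.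
pose c0 i : int := if (om i <= n)%N then 0 else - Num.floor (y i).
(* The other entries are reduced first; [t] is then the value at the origin, whose integral part is
   absorbed by [top] alone. *)
pose t := \sum_(i | i != top) (seps i)%:~R * (y i + (c0 i)%:~R) + y top.
pose c i : int := if i == top then - Num.floor t else c0 i.
have floorP (z : R) : 0 <= z + (- Num.floor z)%:~R < 1.
  have := floor_le z; have := floorD1_gt z; rewrite rmorphN intrD /= => h1 h2.
  by apply/andP; split; lra.
exists (bord g c).
  exists g, c; split=> // i iN; rewrite /c /c0 iN; case: eqP => // it.
  by move: topn; rewrite -it ltnNge iN.
rewrite act_ext; apply/pass_ext; split=> //.
  move=> i ni it; rewrite -/(y i) /c (negPf it) /c0 leqNgt ni; exact: floorP.
have -> : dot (intv R (@seps R S)) (fun i => y i + (c i)%:~R) = t + (- Num.floor t)%:~R.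
  rewrite /dot (bigD1 top)//= {1}/intv epstop mul1r.
  rewrite (eq_bigr (fun i => (seps i)%:~R * (y i + (c0 i)%:~R))) => [|i /negPf it].
    by rewrite /c eqxx; set z := (- _)%:~R; rewrite /t addrAC [y top + _]addrC.
  by rewrite /c it.
exact: floorP.
Qed.

Lemma val_ext_Some g c i : @value R ext_system (bord g c) (Some i) = value g i.
Proof. by rewrite /value big_option /= mul0r add0r. Qed.

Lemma val_ext_None g c :
  @value R ext_system (bord g c) None = \sum_i seps i * c i.
Proof. by rewrite /value big_option /= mul0r add0r. Qed.

Lemma wf_ext : wf ext_system.
Proof.
split=> /=; try by [exact: wf_ext_inv|exact: wf_ext_rec|exact: wf_ext_red].
- move=> _ [g [c [Gg c0 ->]]] [i|]; last by split=> // -[j|].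
  have [g1 g0] := wf_strict wS Gg i.
  by split=> // -[j|] //=; [exact: g0|move=> _; exact: c0].
- by move=> _ [g [c [Gg c0 ->]]] [i|] //=; rewrite (wf_unit wS).
- exact: wf_eps.
- by move=> _ [W [x [GW xP ->]]] [i|] //=; rewrite (wf_unitR wS).
- by exists (@sW0 R S), P; split=> //; exact: wf_W0.
- move=> _ [W [x [GW xP ->]]]; apply: shape_bord; first exact: wf_shape.
  by move=> i iN; rewrite xP ?P0// ltnW.
- move=> _ m _ [g [c [Gg c0 ->]]] [W [x [GW xP ->]]]; rewrite act_ext.
  eexists; eexists; split; last reflexivity; first exact: wf_act.
  move=> i iN /=.
  by rewrite (fixed_column _ Gg)// c0// addr0.
- move=> _ m _ [g [c [Gg c0 ->]]] [g' [c' [Gg' c'0 ->]]].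
  rewrite dil_bord bord_mulf.
  eexists; eexists; split; last reflexivity; first exact: wf_mul.
  move=> i iN /=.
  by rewrite (fixed_zero _ Gg)// c0// addr0.
- move=> _ m _ [g [c [Gg c0 ->]]] [g' [c' [Gg' c'0 ->]]].
  have [g'' Gg'' gE] := wf_div wS m Gg Gg'.
  pose c'' i := c i - app g'' (fun j => m%:R ^+ (om j - n) * c' j) i.
  exists (bord g'' c''); last first.
    rewrite dil_bord bord_mulf -gE; congr bord; apply/funext => i.
    by rewrite /c'' addrC subrK.
  exists g'', c''; split=> // i iN.
  by rewrite /c'' (fixed_zero _ Gg'')// c0// subr0.
- move=> q W Wo Uq GW Wq.
  have GU k : sGrp (ublock (W k)) by have [w [x [Gw xP ->]]] := GW k.
  exists (ublock Wo), (column Wo); split.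
  + by apply: (wf_closed wS Uq GU) => i j; exact: Wq.
  + move=> i iN; apply: (ulim_unique _ (Wq (Some i) None)).
    apply: (ulim_ext (ulim_cst (P i) _)) => // k.
    by have [w [x [Gw xP ->]]] := GW k; rewrite /= xP.
  + apply/funext => -[i|]; apply/funext => -[j|] //=.
      apply: (ulim_unique _ (Wq None (Some j))).
      by apply: (ulim_ext (ulim_cst 0 _)) => // k; have [w [x [Gw xP ->]]] := GW k.
    apply: (ulim_unique _ (Wq None None)).
    by apply: (ulim_ext (ulim_cst 1 _)) => // k; have [w [x [Gw xP ->]]] := GW k.
Qed.

Lemma rep_ext f : rep S f -> rep ext_system f.
Proof.
move=> [a aP]; exists (fun p => if p is Some i then a i else 0).
move=> N _ N0 [g [c [Gg c0 ->]]]; rewrite act_ext => /pass_ext[Pg _ _].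
rewrite big_option horner0 mul0r add0r (aP N g)//; apply: eq_bigr => i _.
by rewrite val_ext_Some.
Qed.

(** The value at the origin of the new column is [f N] plus an integer, and its test places it in
    [[0, 1)]: the integer is minus the integral part of [f N]. *)
Lemma ext_floor (f : nat -> R) :
  (forall N g, (0 < N)%N -> sGam g -> pass (act g N (@sW0 R S)) ->
    f N = \sum_i N%:R ^+ (om i - n) * P i * (value g i)%:~R) ->
  rep ext_system (fun N => (Num.floor (f N))%:~R) /\
  forall N G, (0 < N)%N -> @sGam R ext_system G ->
    @pass R ext_system (@act R ext_system G N (@sW0 R ext_system)) ->
    dot (intv R (lift_row (@seps R S))) ((@act R ext_system G N (@sW0 R ext_system))^~ None) =
    f N - (Num.floor (f N))%:~R.
Proof.
move=> fE.
have key N g c : (0 < N)%N -> @sGam R ext_system (bord g c) -> sGam g ->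
    @pass R ext_system (@act R ext_system (bord g c) N (bord (@sW0 R S) P)) ->
    (\sum_i seps i * c i)%:~R = - (Num.floor (f N))%:~R :> R /\
    dot (intv R (@seps R S)) (fun i => app (toR R g)
      (fun j => N%:R ^+ (om j - n) * P j) i + (c i)%:~R) = f N - (Num.floor (f N))%:~R.
  move=> N0 GG Gg; rewrite act_ext => /pass_ext[Pg _].
  have -> : dot (intv R (@seps R S)) (fun i => app (toR R g)
      (fun j => N%:R ^+ (om j - n) * P j) i + (c i)%:~R) =
      f N + (\sum_i seps i * c i)%:~R.
    rewrite dotD; congr (_ + _); last first.
      by rewrite /dot rmorph_sum; apply: eq_bigr => i _; rewrite rmorphM.
    rewrite dot_app /dot (fE N g)//; apply: eq_bigr => i _.
    rewrite mulrC; congr (_ * _); rewrite rmorph_sum; apply: eq_bigr => j _.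
    by rewrite rmorphM.
  set z := \sum_i _ => zb.
  suff -> : z = - Num.floor (f N) by rewrite rmorphN.
  apply/eqP; rewrite -eqr_oppLR; apply/eqP/esym/floor_def.
  by rewrite intrD rmorphN /=; case/andP: zb => ? ?; apply/andP; split; lra.
split.
  exists (fun p => if p is None then - 1 else 0).
  move=> N _ N0 [g [c [Gg c0 ->]]] PG.
  have GG : @sGam R ext_system (bord g c) by exists g, c.
  have [h _] := key N g c N0 GG Gg PG.
  rewrite big_option val_ext_None h hornerN hornerC mulrNN mul1r big1 ?addr0// => i _.
  by rewrite horner0 mul0r.
move=> N _ N0 [g [c [Gg c0 ->]]] PG.
have GG : @sGam R ext_system (bord g c) by exists g, c.
have [_ <-] := key N g c N0 GG Gg PG.
by rewrite act_ext dot_bord /intv /= add0r.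
Qed.

End ExtensionSystem.

(** * Systems representing generalised polynomials *)

Lemma horner_shift (R : realType) (p : {poly R}) s K (x : R) : (size p + s <= K)%N ->
  \sum_(c < K) (if (s <= c)%N then x ^+ (c - s) * p`_(c - s) else 0) = p.[x].
Proof.
move=> sK; have -> : K = (s + (K - s))%N by lia.
rewrite big_split_ord /= big1 ?add0r => [|c _]; last by rewrite leqNgt ltn_ord.
rewrite (@horner_coef_wide _ (K - s)); last by lia.
by apply: eq_bigr => c _; rewrite leq_addr addKn mulrC.
Qed.

Section Representation.
Variable R : realType.
Implicit Types (S : system R) (f : nat -> R).

Definition extends S S' := forall f, rep S f -> rep S' f.

Lemma floor_step S f : wf S -> rep S f -> exists S', [/\ wf S', extends S S',
  rep S' (fun N => (Num.floor (f N))%:~R) &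
  exists (c : sI S' -> int) (nu : sI S'), forall N g, (0 < N)%N -> sGam g ->
    pass (act g N (@sW0 R S')) ->
    dot (intv R c) ((act g N (@sW0 R S'))^~ nu) = f N - (Num.floor (f N))%:~R].
Proof.
move=> wS [a aP].
pose E := \max_i size (a i); pose D := \max_i @som R S i.
have aE i : (size (a i) <= E)%N by exact: leq_bigmax.
have omD i : (@som R S i <= D)%N by exact: leq_bigmax.
pose T := tens_system S (E + D).+1.
have wT : wf T by exact: wf_tens.
pose n := (D + @som R S (sone S))%N.
(* The coefficient of [N ^ e] in [a i] sits on the copy [d] of [i] with [som i + d = D + e], whose
   weight is [n + e]. The last copy of the constant monomial has weight above [n] and serves as
   [top]. *)
pose P (x : sI T) : R := if (x.1.2 == sone S) && (D <= @som R S x.1.1 + x.2)%N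
  then (a x.1.1)`_(@som R S x.1.1 + x.2 - D) else 0.
pose top : sI T := (sone S, sone S, ord_max).
have P0 x : (@som R T x < n)%N -> P x = 0.
  rewrite /P /= /omT /n; case: eqP => //= -> lt; case: leqP => // le.
  by move: (@som R S _) lt le => *; lia.
have topn : (n < @som R T top)%N.
  by rewrite /n /= /omT /=; move: (@som R S _) => *; lia.
have epstop : @seps R T top = 1 by rewrite /= (wf_eps wS) mulr1.
have fE N G : (0 < N)%N -> @sGam R T G -> pass (act G N (@sW0 R T)) ->
    f N = \sum_x N%:R ^+ (@som R T x - n) * P x * (value G x)%:~R.
  move=> N0 [g Gg ->]; rewrite act_tens//; last exact: wf_W0.
  move=> /pass_tens Pg; rewrite (aP N g)//; last first.
    by apply: Pg => //; apply: wf_act => //; exact: wf_W0.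
  under [RHS]eq_bigr do rewrite val_tens//.
  rewrite (sum3 (fun b c (d : 'I_(E + D).+2) => N%:R ^+ (@som R S b + @som R S c + d - n) *
    (if (c == sone S) && (D <= @som R S b + d)%N then (a b)`_(@som R S b + d - D) else 0) *
    (value g b * value g c)%:~R)).
  apply: eq_bigr => b _; rewrite (bigD1 (sone S))//= [X in _ + X]big1 => [|c /negPf c1].
    rewrite addr0 eqxx /= val_one// mulr1 -mulr_suml; congr (_ * _).
    rewrite -(@horner_shift _ _ (D - @som R S b) (E + D).+2); last first.
      by have := aE b; lia.
    apply: eq_bigr => d _; rewrite -leq_subLR; case: leqP => le; last by rewrite mulr0.
    have -> : (@som R S b + @som R S (sone S) + d - n = d - (D - @som R S b))%N.
      by rewrite /n; have := omD b; move: (@som R S b) (@som R S _) le => *; lia.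
    have -> : (@som R S b + d - D = d - (D - @som R S b))%N.
      by have := omD b; move: (@som R S b) le => *; lia.
    by [].
  by rewrite big1// => d _; rewrite c1 /= mulr0 mul0r.
have wE := wf_ext wT P0 topn epstop.
have [fl test] := ext_floor top fE.
exists (ext_system n P top); split=> //.
  by move=> h /(rep_tens (E + D).+1 wS) /(rep_ext n P top).
by exists (lift_row (@seps R T)), None.
Qed.

Lemma gp_rep (g : 'rV[R]_1 -> R) : generalised_polynomial g ->
  forall S, wf S -> exists S', [/\ wf S', extends S S' &
    rep S' (fun N => g (const_mx N%:R))].
Proof.
elim=> [c|i|f h _ IHf _ IHh|f h _ IHf _ IHh|f _ IHf] S wS.
- by exists S; split=> //; exact: rep_cst.
- exists S; split=> //; have [a aP] := rep_id wS; exists a => N G N0 GG PG.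
  by rewrite mxE; exact: aP.
- have [S1 [wS1 SS1 fS1]] := IHf S wS; have [S2 [wS2 SS2 hS2]] := IHh S1 wS1.
  exists S2; split=> //; first by move=> F /SS1 /SS2.
  by apply: repD => //; exact: SS2.
- have [S1 [wS1 SS1 fS1]] := IHf S wS; have [S2 [wS2 SS2 hS2]] := IHh S1 wS1.
  exists (tens_system S2 0); split; first exact: wf_tens.
    by move=> F /SS1 /SS2; exact: rep_tens.
  by apply: rep_tensM => //; exact: SS2.
- have [S1 [wS1 SS1 fS1]] := IHf S wS; have [S2 [wS2 SS2 flS2 _]] := floor_step wS1 fS1.
  by exists S2; split=> // F /SS1 /SS2.
Qed.

Lemma act_act S g m g' m' W : @sGam R S g' -> wf S -> sGrp W ->
  act (mulf g (dil (@som R S) m g')) (m * m') W = act g m (act g' m' W).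
Proof.
move=> Gg' wS GW; have sg' := strict_shapeW (wf_strict wS Gg').
rewrite /act toR_mulf toR_dil -dil_dil -mulfA dilM//; first exact: shape_toR.
by apply: shape_dil; exact: wf_shape.
Qed.

(** In [2 * z ^ 2 = w ^ 2] the exponent of 2 would be odd on the left and even on the right. *)
Lemma sqrt2_irrational (z : int) : Num.sqrt 2 * z%:~R \is a @Num.int R -> z = 0.
Proof.
move=> /intrP [w zw]; apply/eqP/negPn/negP => z0.
have E : 2 * z ^+ 2 = w ^+ 2.
  apply: (@intr_inj R); rewrite rmorphM !rmorphXn /= -zw exprMn sqr_sqrtr//.
have {}E : (2 * `|z| ^ 2 = `|w| ^ 2)%N.
  by rewrite -!mulnn -[2%N]/`|2%:Z|%N -!abszM -!expr2 E.
have z0' : (0 < `|z|)%N by rewrite absz_gt0.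
have := congr1 (logn 2) E; rewrite lognM ?expn_gt0 ?z0'// !lognX.
by rewrite (logn_prime 2)//=; lia.
Qed.

End Representation.

(** * Conclusion *)

Lemma ex_idempotent_eventually :
  exists q : set_system nat, [/\ UltraFilter q, idempotent q &
    forall m, \forall n \near q, (m <= n)%N].
Proof.
have [|q [Uq Fq Iq]] := ex_idempotent eventually_filter.
  move=> A [m _ mA]; exists m => // a /= ma; exists 0%N => // b _.
  by apply: mA => /=; rewrite (leq_trans ma)// leq_addr.
by exists q; split=> // m; apply: Fq; exists m.
Qed.

Lemma IP_idempotent (A : set nat) : IP_set A ->
  exists p : set_system nat, [/\ UltraFilter p, idempotent p, p A &
    forall m, \forall n \near p, (m <= n)%N].
Proof.
move=> [Apos [u upos uA]].
pose FS n := [set a | exists s : seq nat,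
  [/\ uniq s, s != [::], all (leq n) s & a = (\sum_(i <- s) u i)%N]].
pose F : set_system nat := filter_from setT FS.
have FF : ProperFilter F.
  apply: filter_from_proper; last first.
    by move=> n _; exists (u n), [:: n]; rewrite /= leqnn big_seq1.
  apply: filter_from_filter; first by exists 0%N.
  move=> m m' _ _; exists (maxn m m') => // a [s [us s0 /allP ms ->]].
  by split; exists s; split=> //; apply/allP => i /ms; rewrite geq_max => /andP[].
have FSA n : FS n `<=` A.
  move=> a [s [us s0 _ ->]].
  have -> : (\sum_(i <- s) u i)%N = (\sum_(i <- [fset i in s]%fset) u i)%N.
    apply: perm_big; apply: uniq_perm => //; first exact: fset_uniq.
    by move=> i; rewrite !inE.
  apply: uA; case: s s0 us => [//|i s] _ _.
  by apply/fset0Pn; exists i; rewrite !inE eqxx.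
have [|p [Up Fp Ip]] := ex_idempotent FF.
  move=> B [n _ nB]; exists n => // a [s [us s0 /allP ns ->]].
  (* Taking [t] beyond every index of [s] makes the two index sets disjoint. *)
  exists (maxn n (\max_(i <- s) i).+1) => // b [t [ut t0 /allP mt ->]].
  apply: nB; exists (s ++ t); split.
  - rewrite cat_uniq us ut andbT; apply/hasPn => i /mt; rewrite geq_max => /andP[_ mi].
    apply/negP => si.
    by have := leq_trans mi (leq_bigmax_seq (F := id) i si isT); rewrite ltnn.
  - by case: s s0 {us ns mt}.
  - by apply/allP => i; rewrite mem_cat => /orP[/ns//|/mt]; rewrite geq_max => /andP[].
  - by rewrite big_cat.
have pA : p A by apply: Fp; exists 0%N => //; exact: FSA.
(* If [p] did not pass [m], idempotence would bound [a + b] by [m] for some [a >= m] and some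
   positive [b]. *)
exists p; split=> //; elim=> [|m IH]; first exact: nearW.
have [//|/Ip nm] := ultraVN (fun n => (m.+1 <= n)%N) Up.
have [a [ma anm]] := filter_ex (filterI IH nm).
have [b [bA bnm]] := filter_ex (filterI pA anm).
by case: bnm; have := Apos _ bA; rewrite /posnats /=; lia.
Qed.

Lemma near_infinite (q : set_system nat) (A : set nat) : ProperFilter q ->
  (forall m, \forall n \near q, (m <= n)%N) -> (\forall n \near q, A n) ->
  infinite_set A.
Proof.
move=> Fq qinf qA /finite_fsetP [X AX].
have [n [An Xn]] := filter_ex (filterI qA (qinf (\max_(i <- X) i).+1)).
move: An; rewrite AX /= => nX.
by have := leq_trans Xn (leq_bigmax_seq (F := id) n nX isT); rewrite ltnn.
Qed.

Lemma IP_recurrence (R : realType) (k : nat) (E : set nat) (A : set nat) :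
  (2 <= k)%N -> generalised_polynomial_set R E -> (forall n, E (k ^ n)%N) ->
  IP_set A -> exists2 a, A a &
    exists l, infinite_set [set n | E (a.+1 * k ^ (l + n))%N].
Proof.
move=> k2 [f gpf EE] Ek IPA.
have fk n : f (const_mx (k ^ n)%:R) = 0 by have := Ek n; rewrite EE => -[].
have k0 n : (0 < k ^ n)%N by rewrite expn_gt0; lia.
(* The integral part of [- f ^ 2] is 0 exactly where [f] is 0. Times [sqrt 2], a nonzero integer is
   never integral, so the zeros of [f] are those of the fractional part of [h'], which [floor_step]
   exhibits as a linear form. *)
pose h (x : 'rV[R]_1) : R := (Num.floor (- 1 * (f x * f x)))%:~R.
pose h' (x : 'rV[R]_1) : R := Num.sqrt 2 * h x.
have gph : generalised_polynomial h'.
  apply: (gp_mul (gp_const _ (Num.sqrt 2))); apply: gp_floor.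
  by apply: (gp_mul (gp_const _ (- 1))); exact: gp_mul.
have [S0 [wS0 _ hS0]] := gp_rep gph (wf_base R).
have [S [wS _ _ [c [nu test]]]] := floor_step wS0 hS0.
have W0 := wf_W0 wS.
have /choice [gm gmP] : forall m, exists g, sGam g /\ pass (act g m (@sW0 R S)).
  by move=> m; have [g Gg Pg] := wf_red wS m; exists g.
pose W n := act (gm (k ^ n)%N) (k ^ n) (@sW0 R S).
have GW n : sGrp (W n) by apply: wf_act => //; case: (gmP (k ^ n)%N).
have PW n : pass (W n) by case: (gmP (k ^ n)%N).
have [C CP] := wf_inv wS.
have /choice [V VP] : forall n, exists V, [/\ shape (@som R S) V,
    mulf (W n) V = @idf R _, mulf V (W n) = @idf R _ & forall i j, `|V i j| <= C].
  by move=> n; have [_] := CP _ (GW n) (PW n).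
have WC n i j : `|W n i j| <= C by have [] := CP _ (GW n) (PW n).
have /choice [g gP] : forall ln : nat * nat, exists g, sGam g /\
    gm (k ^ (ln.1 + ln.2))%N = mulf g (dil (@som R S) (k ^ ln.1) (gm (k ^ ln.2)%N)).
  move=> [l n]; have [G1 _] := gmP (k ^ (l + n))%N; have [G2 _] := gmP (k ^ n)%N.
  by have [g Gg ->] := wf_div wS (k ^ l) G1 G2; exists g.
have Wg l n : W (l + n)%N = mulf (toR R (g (l, n))) (dil (@som R S) (k ^ l) (W n)).
  have [Gg gE] := gP (l, n); rewrite /W gE expnD act_act//.
  by case: (gmP (k ^ n)%N).
have [q [Uq Iq qinf]] := ex_idempotent_eventually.
(* [Some j] stands for the tests of the domain, [None] for the fractional part that detects
   membership in [E]. *)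
pose cs (j : option (sJ S)) := if j is Some j then (stst j).1.1 else c.
pose nus (j : option (sJ S)) := if j is Some j then (stst j).1.2 else nu.
have [l0 [Wo [Wolim [e [m0 [e0 stable]]]]]] :=
  stable_signs (g := fun l n => g (l, n)) k2 Uq Iq qinf
  (fun n => wf_shape wS (GW n)) (fun n => let: And4 s _ _ _ := VP n in s)
  (fun n => let: And4 _ s _ _ := VP n in s) (fun n => let: And4 _ _ s _ := VP n in s)
  Wg WC (fun n => let: And4 _ _ _ s := VP n in s) cs nus.
have GWo : sGrp Wo by apply: (wf_closed wS Uq _ Wolim) => n; exact: GW.
have [p [Up Ip pA pinf]] := IP_idempotent IPA.
have [ga [Gga _ galim]] := wf_rec wS Up Ip GWo.
have clq : \forall a \near p, forall i j, `|act (ga a) a.+1 Wo i j - Wo i j| < e.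
  by apply: filter_forall => i; apply: filter_forall => j; exact: ulimE (galim i j) e0.
have [a [[cla m0a] Aa]] := filter_ex (filterI (filterI clq (pinf m0)) pA).
exists a => //; exists l0; apply: (near_infinite _ qinf).
apply: filterS (stable a.+1 (ga a) (leqW m0a) cla) => n sgn.
pose G := mulf (ga a) (dil (@som R S) a.+1 (gm (k ^ (l0 + n))%N)).
pose N := (a.+1 * k ^ (l0 + n))%N.
have N0 : (0 < N)%N by rewrite muln_gt0 k0.
have [Gk _] := gmP (k ^ (l0 + n))%N.
have GG : sGam G by exact: wf_mul.
have GE : act G N (@sW0 R S) = mulf (toR R (ga a)) (dil (@som R S) a.+1 (W (l0 + n)%N)).
  by rewrite /G /N act_act.
have PG : pass (act G N (@sW0 R S)).
  move=> j; have := PW (l0 + n)%N j; have := sgn (Some j).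
  rewrite /cs /nus GE /intv /test_pos.
  by case: (stst j).2 => sgE; [rewrite -sgr_gt0 -sgE sgr_gt0|rewrite -sgr_ge0 -sgE sgr_ge0].
have h0 : h (const_mx N%:R) = 0.
  have := test _ _ (k0 (l0 + n)%N) Gk (PW _).
  have -> : h' (const_mx (k ^ (l0 + n))%:R) = 0.
    by rewrite /h' /h fk mulr0 mulr0 floor0 mulr0.
  rewrite floor0 subr0 => t0.
  have := sgn None; rewrite /cs /nus -/(intv R c) -/(W _) t0 sgr0 -GE.
  rewrite (test _ _ N0 GG PG) => /eqP; rewrite sgr_eq0 subr_eq0 => /eqP hE.
  have /sqrt2_irrational z0 : Num.sqrt 2 * (Num.floor (- 1 * (f (const_mx N%:R) *
      f (const_mx N%:R))))%:~R \is a @Num.int R.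
    by rewrite -[X in X \is a _]/(h' (const_mx N%:R)) hE intr_int.
  by rewrite /h z0.
rewrite /= EE; split=> //; apply/eqP; rewrite -sqrf_eq0 eq_le sqr_ge0 andbT.
have := floor_le (- 1 * (f (const_mx N%:R) * f (const_mx N%:R))).
by rewrite -[X in X <= _]/(h (const_mx N%:R)) h0 mulN1r oppr_ge0 expr2.
Qed.

Theorem theoremA (R : realType) (k : nat) (hk : (2 <= k)%N) :
  (forall E : set nat,
     generalised_polynomial_set R E ->
     (forall n : nat, E (k ^ n)%N) ->
     IP_star_plus
       [set m : nat | posnats m /\ infinite_set [set n : nat | E (m * k ^ n)%N]])
  /\ ~ generalised_polynomial_set R [set (k ^ n)%N | n in [set: nat]].
Proof.
split=> [E gpE Ek|gpE].
  (* Recurrence produces [a.+1] with [a] in the given IP set, hence the shift by one. *)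
  exists (- 1); split; first by move=> n [].
  move=> A IPA; have [a Aa [l infE]] := IP_recurrence hk gpE Ek IPA.
  exists a; split=> //; split; first by case: IPA => + _; apply.
  exists a.+1; last by rewrite -addn1 PoszD addrK.
  split=> // fin; apply: infE; have /finite_fsetP [X EX] := fin.
  apply: (@sub_finite_set _ _ [set` [fset (n - l)%N | n in X]%fset]) => // n /= Eln.
  have : [set` X] (l + n)%N by rewrite -EX.
  by move=> /= lnX; apply/imfsetP; exists (l + n)%N => //=; rewrite addKn.
(* All sums of copies of [k] are multiples of [k], and [1 + k b] is coprime to [k]. *)
pose A := [set n : nat | (0 < n)%N /\ (k %| n)%N].
have IPA : IP_set A.
  split; first by move=> n [].
  exists (fun=> k); first by move=> _; rewrite /posnats /=; lia.
  move=> I /fset0Pn [i iI]; split; last by apply: dvdn_sum.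
  by rewrite (big_fsetD1 i)//=; lia.
have [a [a0 ka] [l infE]] := IP_recurrence hk gpE (fun n => ex_intro2 _ _ n I erefl) IPA.
have [n [j _ jE]] := infinite_setN0 infE.
have copr : coprime k a.+1.
  rewrite -addn1 coprime_sym /coprime; have /dvdnP[b ->] := ka.
  by rewrite gcdnC gcdnMDl gcdn1.
have dv : (a.+1 %| k ^ j)%N by rewrite jE dvdn_mulr.
have := coprimeXl j copr; rewrite /coprime => /eqP gE.
have : (a.+1 %| gcdn (k ^ j) a.+1)%N by rewrite dvdn_gcd dv dvdnn.
by rewrite gE dvdn1; lia.
Qed.
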